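(* (1) For every $l\in\mathbb N$ and every $\omega>0$, the semiaxis $\Lambda_l^+(\omega)$ contains at least one generalized simple intersection lying in $\partial L_l(\omega)$. (2) For every $l,s\in\mathbb N$ with $l\geq 3$, $s\equiv l\pmod 2$, $0<s<l$, and every $\omega>0$ small enough (depending on $l$), the semiaxis $\Lambda_l^+(\omega)$ intersects each of the two boundary components $\partial L_{s,+}(\omega)$ and $\partial L_{s,-}(\omega)$. (3) For every $l\geq 2$ and every $\omega>0$ small enough, the boundary component $\partial L_{0,+}(\omega)$ intersects $\Lambda_l^+(\omega)$.
   Context: Fix $\omega>0$. For $(B,A)\in\mathbb R^2$ consider $\frac{d\varphi}{dt}=-\sin\varphi+B+A\cos\omega t$. With $\tau=\omega t$, $l=B/\omega$, $\mu=A/(2\omega)$, its solutions are the orbits of the vector field $\dot\varphi=-\frac{\sin\varphi}{\omega}+l+2\mu\cos\tau$, $\dot\tau=1$ on the torus $\mathbb R^2/2\pi\mathbb Z^2$ with coordinates $(\varphi,\tau)$. The rotation number is $\rho(B,A;\omega)=\lim_{k\to+\infty}\varphi(2\pi k)/(2\pi k)$ for any solution $\varphi(\tau)$. For $s\in\mathbb Z$ the phase-lock area is $L_s=L_s(\omega)=\{(B,A):\rho(B,A;\omega)=s\}$. The Poincaré map $h_{(B,A)}$ is the time-$2\pi$ flow map of this vector field acting on the circle $\{\tau=0\}=\mathbb R/2\pi\mathbb Z$. The boundary $\partial L_s$ is the union of two curves $\partial L_{s,\pm}(\omega)$, where $\partial L_{s,\pm}(\omega)$ consists of those points of $L_s$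 for which $h_{(B,A)}$ fixes the point $\pm\frac{\pi}{2}\pmod{2\pi}$. A constriction is a point $(B,A)$ of some $L_s$ with $A\neq0$ at which $h_{(B,A)}$ is the identity. The axis is $\Lambda_l(\omega)=\{B=l\omega\}$ and $\Lambda_l^+(\omega)=\Lambda_l(\omega)\cap\{A\geq0\}$. A generalized simple intersection is a point of intersection of an axis $\Lambda_l(\omega)$ with the boundary $\partial L_s(\omega)$ of a phase-lock area with $s\equiv l\pmod 2$ that is not a constriction. *)

(* Defs.v *)
From Stdlib Require Import Reals ZArith.
From Coquelicot Require Import Coquelicot.
Open Scope R_scope.

(* The vector field  dphi/dtau = -sin(phi)/omega + l + 2 mu cos(tau),
   with l = B/omega and mu = A/(2 omega). *)
Definition vf (omega B A phi tau : R) : R :=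
  - sin phi / omega + B / omega + 2 * (A / (2 * omega)) * cos tau.

(* phi : R -> R is a (lifted) solution, i.e. an orbit of the field on the
   torus written in the universal cover in phi and parametrized by tau. *)
Definition is_solution (omega B A : R) (phi : R -> R) : Prop :=
  forall tau, is_derive phi tau (vf omega B A (phi tau) tau).

Definition rotation_number_is (omega B A r : R) : Prop :=
  forall phi, is_solution omega B A phi ->
    is_lim_seq (fun k : nat => phi (2 * PI * INR k) / (2 * PI * INR k)) r.

Definition in_L (s : Z) (omega B A : R) : Prop :=
  rotation_number_is omega B A (IZR s).

Definition poincare_fixes (omega B A p : R) : Prop :=
  exists phi, is_solution omega B A phi /\ phi 0 = p /\
    exists n : Z, phi (2 * PI) = p + 2 * PI * IZR n.

Definition poincare_identity (omega B A : R) : Prop :=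
  forall phi, is_solution omega B A phi ->
    exists n : Z, phi (2 * PI) = phi 0 + 2 * PI * IZR n.

Definition boundary_plus (s : Z) (omega B A : R) : Prop :=
  in_L s omega B A /\ poincare_fixes omega B A (PI / 2).
Definition boundary_minus (s : Z) (omega B A : R) : Prop :=
  in_L s omega B A /\ poincare_fixes omega B A (- (PI / 2)).
Definition boundary (s : Z) (omega B A : R) : Prop :=
  boundary_plus s omega B A \/ boundary_minus s omega B A.

Definition constriction (omega B A : R) : Prop :=
  (exists s : Z, in_L s omega B A) /\ A <> 0 /\ poincare_identity omega B A.

Definition on_semiaxis (l : Z) (omega B A : R) : Prop :=
  B = IZR l * omega /\ 0 <= A.

Definition gen_simple_intersection (omega B A : R) : Prop :=
  exists l s : Z, B = IZR l * omega /\ boundary s omega B A /\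
    Z.modulo (s - l) 2 = 0%Z /\ ~ constriction omega B A.

(* Main.v *)
(** The phase equation [phi' = l + 2 mu cos t - 2 n sin phi], with
[n = 1/(2 omega)] and [mu = A/(2 omega)], is the projectivization of a linear
system whose first component [u] solves [u'' - i (l + 2 mu cos t) u' = n^2 u].
With [z = exp (i t)], a solution [u = exp (mu z) E(z)], [E] a polynomial
[sum_j (-1)^j b_j z^j] of degree [l - 1], fixes [+-PI/2] as soon as
[mu b_m = (m+1) b_(m+1) + n b_(l-1-m)]: [b] is an eigenvector of a nonnegative
irreducible matrix, so for each [n > 0] the Perron-Frobenius eigenvalue gives
such a [mu]. The advance of the resulting orbit over a period is a multiple of
[2 PI], depends continuously on [n], and is [2 PI l] for small [n]; hence the
rotation number is [l] for all [n].

The Poincare map is not the identity there: otherwise the Fourier coefficients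
[V_m] ([m >= 0]) of a second solution would satisfy
[mu (V_(m+1) + V_(m-1)) = - (m + l + n^2/m) V_m], [V_0 = 0]. As
[mu <= n + (l-1)/2], the coefficient is at least [2 mu], so boundedness forces
[V = 0]; but the Wronskian with the first solution has the nonzero coefficient
[2 PI (-mu)^l / l!].

For [0 <= s < l] and [l omega < 1], move [A] from [0], where the orbits of
[+-PI/2] do not advance enough, to the value above, where they advance by at
least [2 PI l - PI]: by the intermediate value theorem they advance by exactly
[2 PI s] in between. *)

Require Import Defs.
From Stdlib Require Import Reals ZArith Lra Lia Psatz Nsatz ClassicalEpsilon.
From Coquelicot Require Import Coquelicot.
Open Scope R_scope.

(** * Orbits of the phase equation *)

Lemma is_derive_value (f : R -> R) (x l l' : R) :
  is_derive f x l -> l = l' -> is_derive f x l'.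
Proof. now intros H <-. Qed.

Lemma is_derive_mul (f g : R -> R) (t df dg : R) : is_derive f t df -> is_derive g t dg ->
  is_derive (fun t => f t * g t) t (df * g t + f t * dg).
Proof. intros Hf Hg; apply (is_derive_mult f g); trivial; intros; apply Rmult_comm. Qed.

Lemma is_derive_sin_comp (f : R -> R) (t df : R) : is_derive f t df ->
  is_derive (fun t => sin (f t)) t (df * cos (f t)).
Proof. intros Hf; apply (is_derive_comp sin f); [apply is_derive_sin | trivial]. Qed.

Lemma is_derive_cos_comp (f : R -> R) (t df : R) : is_derive f t df ->
  is_derive (fun t => cos (f t)) t (df * - sin (f t)).
Proof. intros Hf; apply (is_derive_comp cos f); [apply is_derive_cos | trivial]. Qed.

(** The product [g x * exp (- K * x)] has derivative [(dg x - K * g x) * exp (- K * x) <= 0], so the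
    mean value theorem makes it nonincreasing. *)
Lemma gronwall (g dg : R -> R) (K s t : R) :
  s <= t -> (forall x, is_derive g x (dg x)) ->
  (forall x, dg x <= K * g x) -> g t <= g s * exp (K * (t - s)).
Proof.
intros Hst Hd Hle.
destruct (MVT_gen (fun x => g x * exp (- K * x)) s t
  (fun x => dg x * exp (- K * x) + g x * (- K * exp (- K * x)))) as [c [_ Hc]].
- intros x _; apply (is_derive_mult g (fun x => exp (- K * x))); [apply Hd | | ].
  + auto_derive; [trivial | ring].
  + intros; apply Rmult_comm.
- intros x _; apply continuity_pt_filterlim.
  apply (continuous_mult g (fun x => exp (- K * x))).
  + apply (ex_derive_continuous g); eexists; apply Hd.
  + apply (ex_derive_continuous (fun x => exp (- K * x))); auto_derive; trivial.
- assert (Hx : g t * exp (- K * t) <= g s * exp (- K * s)).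
  { specialize (Hle c); pose proof (exp_pos (- K * c)).
    cut ((dg c * exp (- K * c) + g c * (- K * exp (- K * c))) * (t - s) <= 0); [lra |].
    replace (dg c * exp (- K * c) + g c * (- K * exp (- K * c)))
      with (- (exp (- K * c) * (K * g c - dg c))) by ring.
    assert (0 <= exp (- K * c) * (K * g c - dg c)) by (apply Rmult_le_pos; lra).
    nra. }
  apply Rmult_le_compat_r with (r := exp (K * t)) in Hx; [| left; apply exp_pos].
  rewrite !Rmult_assoc, <- !exp_plus in Hx.
  replace (- K * t + K * t) with 0 in Hx by ring.
  rewrite exp_0, Rmult_1_r in Hx.
  now replace (K * (t - s)) with (- K * s + K * t) by ring.
Qed.

(** The square of [g] obeys Gronwall's inequality with rate [2 * K] and vanishes at [s]. Times
    before [s] follow by reversing time. *)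
Lemma linear_ode_zero (g c : R -> R) (K s t : R) :
  (forall x, is_derive g x (c x * g x)) ->
  (forall x, Rabs (c x) <= K) -> g s = 0 -> g t = 0.
Proof.
assert (Hfwd : forall (g c : R -> R) (s t : R), s <= t ->
  (forall x, is_derive g x (c x * g x)) ->
  (forall x, Rabs (c x) <= K) -> g s = 0 -> g t = 0).
{ clear; intros g c s t Hst Hd Hc H0.
  assert (H : g t * g t <= g s * g s * exp (2 * K * (t - s))).
  { apply (gronwall (fun x => g x * g x) (fun x => 2 * c x * (g x * g x))); trivial.
    - intros x; eapply is_derive_value.
      + apply (is_derive_mult g g); [apply Hd | apply Hd | intros; apply Rmult_comm].
      + unfold plus, mult; simpl; ring.
    - intros x; pose proof (Rle_abs (c x)); specialize (Hc x).
      assert (0 <= g x * g x) by nra. nra. }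
  rewrite H0 in H; nra. }
intros Hd Hc H0.
destruct (Rle_dec s t) as [Hst | Hst]; [now apply (Hfwd g c s t) |].
rewrite <- (Ropp_involutive t).
apply (Hfwd (fun x => g (- x)) (fun x => - c (- x)) (- s) (- t)); [lra | | |].
- intros x; eapply is_derive_value.
  + apply (is_derive_comp g (fun x => - x)); [apply Hd |].
    auto_derive; [trivial | reflexivity].
  + unfold scal; simpl; unfold mult; simpl; ring.
- intros x; rewrite Rabs_Ropp; apply Hc.
- now rewrite Ropp_involutive.
Qed.

Lemma sin_lipschitz (x y : R) : Rabs (sin x - sin y) <= Rabs (x - y).
Proof.
destruct (MVT_gen sin y x cos) as [c [_ Hc]].
- intros; apply is_derive_sin.
- intros; apply continuity_sin.
- rewrite Hc, Rabs_mult; pose proof (COS_bound c).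
  assert (Rabs (cos c) <= 1) by (apply Rabs_le; lra).
  pose proof (Rabs_pos (x - y)); nra.
Qed.

Lemma is_derive_continuous (f : R -> R) (x l : R) : is_derive f x l -> continuous f x.
Proof. intros H; apply (ex_derive_continuous f); now exists l. Qed.

(** The phase equation with [a = l] and [k = 1 / omega = 2 n]. Separate coefficients allow
    deformations in [mu] alone or in [mu] and [k] together. *)
Definition is_orbit (a mu k : R) (phi : R -> R) : Prop :=
  forall t, is_derive phi t (a + 2 * mu * cos t - k * sin (phi t)).

(** In the norm with weight [exp (- M * Rabs t)], integration from 0 has norm at most [1 / M]. A
    large [M] makes the Picard operator a contraction on the whole line at once. *)
Lemma RInt_exp_bound (f : R -> R) (D M t : R) :
  0 < M -> (forall s, continuous f s) -> (forall s, Rabs (f s) <= D * exp (M * Rabs s)) ->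
  Rabs (RInt f 0 t) <= D / M * exp (M * Rabs t).
Proof.
intros HM Hf Hb.
assert (HD : 0 <= D).
{ specialize (Hb 0); rewrite Rabs_R0, Rmult_0_r, exp_0 in Hb.
  pose proof (Rabs_pos (f 0)); lra. }
assert (HDM : 0 <= D / M) by (apply Rdiv_le_0_compat; lra).
assert (Hex : forall a b, ex_RInt f a b) by (intros; apply (ex_RInt_continuous f); auto).
destruct (Rle_dec 0 t) as [Ht | Ht].
- rewrite (Rabs_right t) by lra.
  apply Rle_trans with (D / M * exp (M * t) - D / M * exp (M * 0)).
  + apply (norm_RInt_le f (fun s => D * exp (M * s)) 0 t); trivial.
    * intros x Hx; rewrite <- (Rabs_right x) at 2 by lra; apply Hb.
    * apply (RInt_correct f), Hex.
    * apply (is_RInt_derive (fun s => D / M * exp (M * s)) (fun s => D * exp (M * s))).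
      -- intros x _; auto_derive; trivial; field; lra.
      -- intros x _; apply (ex_derive_continuous (fun s => D * exp (M * s)));
         auto_derive; trivial.
  + pose proof (exp_pos (M * 0)); nra.
- rewrite (Rabs_left t) by lra.
  rewrite <- (opp_RInt_swap f) by apply Hex.
  unfold opp; simpl; rewrite Rabs_Ropp.
  apply Rle_trans with (- (D / M) * exp (M * - 0) - - (D / M) * exp (M * - t)).
  + apply (norm_RInt_le f (fun s => D * exp (M * - s)) t 0); [lra | | |].
    * intros x Hx; rewrite <- (Rabs_left1 x) by lra; apply Hb.
    * apply (RInt_correct f), Hex.
    * apply (is_RInt_derive (fun s => - (D / M) * exp (M * - s)) (fun s => D * exp (M * - s))).
      -- intros x _; auto_derive; trivial; field; lra.
      -- intros x _; apply (ex_derive_continuous (fun s => D * exp (M * - s)));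
         auto_derive; trivial.
  + pose proof (exp_pos (M * - 0)); nra.
Qed.

(** * Global existence of orbits by Picard iteration *)

Section Picard.
Variables a mu k p : R.

Let rhs (phi : R -> R) (s : R) : R := a + 2 * mu * cos s - k * sin (phi s).

Fixpoint picard (j : nat) : R -> R :=
  match j with
  | O => fun _ => p
  | S j => fun t => p + RInt (rhs (picard j)) 0 t
  end.

(** [C] bounds the field and [L] is a Lipschitz constant in the phase; adding 1 keeps [L] nonzero
    when [k = 0]. *)
Let C := Rabs a + 2 * Rabs mu + Rabs k.
Let L := Rabs k + 1.

Lemma rhs_bound (phi : R -> R) (s : R) : Rabs (rhs phi s) <= C.
Proof.
unfold rhs, C.
pose proof (COS_bound s); pose proof (SIN_bound (phi s)).
assert (Rabs (2 * mu * cos s) <= 2 * Rabs mu).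
{ rewrite !Rabs_mult, (Rabs_right 2) by lra.
  assert (Rabs (cos s) <= 1) by (apply Rabs_le; lra).
  pose proof (Rabs_pos mu); nra. }
assert (Rabs (k * sin (phi s)) <= Rabs k).
{ rewrite Rabs_mult.
  assert (Rabs (sin (phi s)) <= 1) by (apply Rabs_le; lra).
  pose proof (Rabs_pos k); nra. }
unfold Rminus; eapply Rle_trans; [apply Rabs_triang |]; rewrite Rabs_Ropp.
pose proof (Rabs_triang a (2 * mu * cos s)); lra.
Qed.

Lemma rhs_continuous (phi : R -> R) (s : R) : continuous phi s -> continuous (rhs phi) s.
Proof.
intros H; unfold rhs.
apply (continuous_minus (fun s => a + 2 * mu * cos s) (fun s => k * sin (phi s))).
- apply (ex_derive_continuous (fun s => a + 2 * mu * cos s)); auto_derive; trivial.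
- apply (continuous_mult (fun _ => k) (fun s => sin (phi s))).
  + apply continuous_const.
  + apply (continuous_comp phi sin); trivial.
    apply (ex_derive_continuous sin); auto_derive; trivial.
Qed.

Lemma rhs_RInt_derive (phi : R -> R) (t : R) :
  (forall s, continuous phi s) ->
  is_derive (fun t => p + RInt (rhs phi) 0 t) t (rhs phi t).
Proof.
intros H; eapply is_derive_value.
- apply (is_derive_plus (fun _ => p) (fun t => RInt (rhs phi) 0 t)).
  + apply is_derive_const.
  + apply (is_derive_RInt (rhs phi) _ 0).
    * exists (mkposreal 1 Rlt_0_1); intros y _.
      apply (RInt_correct (rhs phi)), ex_RInt_continuous.
      intros; now apply rhs_continuous.
    * now apply rhs_continuous.
- unfold plus, zero; simpl; ring.
Qed.

Lemma picard_continuous (j : nat) (t : R) : continuous (picard j) t.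
Proof.
revert t; induction j as [|j IH]; intros t.
- apply continuous_const.
- eapply is_derive_continuous, rhs_RInt_derive, IH.
Qed.

(** The bound [C] on the field does not depend on [j], so this estimate passes to the limit and
    gives its continuity. *)
Lemma picard_lipschitz (j : nat) (s t : R) :
  Rabs (picard j s - picard j t) <= C * Rabs (s - t).
Proof.
assert (HC : 0 <= C).
{ unfold C; pose proof (Rabs_pos a); pose proof (Rabs_pos mu); pose proof (Rabs_pos k); lra. }
destruct j as [|j].
- simpl; replace (p - p) with 0 by ring; rewrite Rabs_R0.
  apply Rmult_le_pos; [trivial | apply Rabs_pos].
- destruct (MVT_gen (picard (S j)) t s (rhs (picard j))) as [c [_ Hc]].
  + intros x _; apply rhs_RInt_derive; intros; apply picard_continuous.
  + intros x _; apply continuity_pt_filterlim, (picard_continuous (S j)).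
  + rewrite Hc, Rabs_mult; pose proof (rhs_bound (picard j) c); pose proof (Rabs_pos (s - t)); nra.
Qed.

(** With weight [exp (2 * L * Rabs t)], the Lipschitz constant [L] and the gain [1 / (2 * L)] of
    integration combine to a contraction factor [1 / 2]. *)
Lemma picard_step (j : nat) (t : R) :
  Rabs (picard (S j) t - picard j t) <= C * (/ 2) ^ j * exp (2 * L * Rabs t).
Proof.
assert (HC : 0 <= C).
{ unfold C; pose proof (Rabs_pos a); pose proof (Rabs_pos mu); pose proof (Rabs_pos k); lra. }
assert (HL : 1 <= L) by (unfold L; pose proof (Rabs_pos k); lra).
revert t; induction j as [|j IH]; intros t.
(* [picard 0] is the constant [p], also the value of [picard 1] at 0, so the first difference is an
   increment of [picard 1]. *)
- assert (H1 : picard 1 0 = picard 0 t) by (simpl; rewrite RInt_point; apply Rplus_0_r).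
  rewrite <- H1; eapply Rle_trans; [apply picard_lipschitz |].
  rewrite Rminus_0_r; simpl; rewrite Rmult_1_r.
  apply Rmult_le_compat_l; trivial.
  pose proof (exp_ineq1_le (2 * L * Rabs t)); pose proof (Rabs_pos t); nra.
- assert (Hex : forall i b, ex_RInt (rhs (picard i)) 0 b).
  { intros; apply (ex_RInt_continuous (rhs (picard i))); intros; apply rhs_continuous, picard_continuous. }
  replace (picard (S (S j)) t - picard (S j) t) with
    (RInt (fun s => rhs (picard (S j)) s - rhs (picard j) s) 0 t).
  2: { rewrite (RInt_minus (rhs (picard (S j))) (rhs (picard j))) by apply Hex.
       unfold minus, plus, opp; simpl; ring. }
  replace (C * (/ 2) ^ S j * exp (2 * L * Rabs t)) with
    ((C * (/2) ^ j * L) / (2 * L) * exp (2 * L * Rabs t)) by (simpl; field; lra).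
  apply RInt_exp_bound; [lra | |].
  + intros s; apply (continuous_minus (rhs (picard (S j))) (rhs (picard j)));
      apply rhs_continuous, picard_continuous.
  + intros s; unfold rhs.
    replace (a + 2 * mu * cos s - k * sin (picard (S j) s) - (a + 2 * mu * cos s - k * sin (picard j s)))
      with (- k * (sin (picard (S j) s) - sin (picard j s))) by ring.
    rewrite Rabs_mult, Rabs_Ropp.
    pose proof (sin_lipschitz (picard (S j) s) (picard j s)); specialize (IH s).
    assert (Rabs k <= L) by (unfold L; lra).
    pose proof (Rabs_pos (sin (picard (S j) s) - sin (picard j s))).
    pose proof (Rabs_pos k).
    replace (C * (/ 2) ^ j * L * exp (2 * L * Rabs s))
      with (L * (C * (/ 2) ^ j * exp (2 * L * Rabs s))) by ring.
    apply Rmult_le_compat; lra.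
Qed.

(** Geometric sum of the steps; the exact factor [1 - (/ 2) ^ i] is kept so that the induction
    closes. *)
Lemma picard_tail (j i : nat) (t : R) :
  Rabs (picard (j + i) t - picard j t) <= 2 * C * (/ 2) ^ j * exp (2 * L * Rabs t) * (1 - (/ 2) ^ i).
Proof.
induction i as [|i IH].
- rewrite Nat.add_0_r; simpl.
  replace (picard j t - picard j t) with 0 by ring; rewrite Rabs_R0; lra.
- rewrite Nat.add_succ_r; pose proof (picard_step (j + i) t) as Hs.
  rewrite pow_add in Hs.
  replace (picard (S (j + i)) t - picard j t) with
    ((picard (S (j + i)) t - picard (j + i) t) + (picard (j + i) t - picard j t)) by ring.
  eapply Rle_trans; [apply Rabs_triang |].
  replace ((/ 2) ^ S i) with (/ 2 * (/ 2) ^ i) by reflexivity.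
  nra.
Qed.

Lemma orbit_exists_aux : exists phi, is_orbit a mu k phi /\ phi 0 = p.
Proof.
assert (HC : 0 <= C).
{ unfold C; pose proof (Rabs_pos a); pose proof (Rabs_pos mu); pose proof (Rabs_pos k); lra. }
assert (HL : 1 <= L) by (unfold L; pose proof (Rabs_pos k); lra).
assert (Hpow : forall j, 0 < (/ 2) ^ j) by (intros; apply pow_lt; lra).
assert (Htail : forall j i t, Rabs (picard (j + i) t - picard j t)
          <= 2 * C * (/ 2) ^ j * exp (2 * L * Rabs t)).
{ intros j i t; eapply Rle_trans; [apply picard_tail |].
  assert (0 <= 2 * C * (/ 2) ^ j * exp (2 * L * Rabs t)).
  { repeat apply Rmult_le_pos; try lra; [apply Rlt_le, Hpow | apply Rlt_le, exp_pos]. }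
  specialize (Hpow i); nra. }
assert (Hgeom : forall t, is_lim_seq (fun j => 2 * C * (/ 2) ^ j * exp (2 * L * Rabs t)) 0).
{ intros t.
  replace (Finite 0) with (Rbar_mult (Rbar_mult (2 * C) 0) (exp (2 * L * Rabs t))) by (simpl; f_equal; ring).
  apply is_lim_seq_scal_r, is_lim_seq_scal_l, is_lim_seq_geom; rewrite Rabs_right; lra. }
assert (Hlim : forall t, exists l : R, is_lim_seq (fun j => picard j t) l).
{ intros t; apply ex_lim_seq_cauchy_corr.
  intros eps; specialize (Hgeom t); apply is_lim_seq_spec in Hgeom.
  destruct (Hgeom (mkposreal (eps / 2) (is_pos_div_2 eps))) as [N HN]; simpl in HN.
  exists N; intros m j Hm Hj.
  replace m with (N + (m - N))%nat by lia; replace j with (N + (j - N))%nat by lia.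
  pose proof (Htail N (m - N)%nat t); pose proof (Htail N (j - N)%nat t).
  specialize (HN N (le_n _)); rewrite Rminus_0_r in HN.
  pose proof (Rle_abs (2 * C * (/ 2) ^ N * exp (2 * L * Rabs t))).
  replace (picard (N + (m - N)) t - picard (N + (j - N)) t) with
    ((picard (N + (m - N)) t - picard N t) - (picard (N + (j - N)) t - picard N t)) by ring.
  unfold Rminus at 1; eapply Rle_lt_trans; [apply Rabs_triang |]; rewrite Rabs_Ropp; lra. }
pose (phi := fun t => real (Lim_seq (fun j => picard j t))).
assert (Hphi : forall t, is_lim_seq (fun j => picard j t) (phi t)).
{ intros t; destruct (Hlim t) as [l Hl]; unfold phi; rewrite (is_lim_seq_unique _ _ Hl); exact Hl. }
assert (Happ : forall j t, Rabs (phi t - picard j t) <= 2 * C * (/ 2) ^ j * exp (2 * L * Rabs t)).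
{ intros j t.
  apply (is_lim_seq_le (fun i => Rabs (picard (j + i) t - picard j t))
    (fun _ => 2 * C * (/ 2) ^ j * exp (2 * L * Rabs t))
    (Rabs (phi t - picard j t)) (2 * C * (/ 2) ^ j * exp (2 * L * Rabs t))).
  - intros; apply Htail.
  - apply (is_lim_seq_abs _ (phi t - picard j t)).
    apply is_lim_seq_minus'; [| apply is_lim_seq_const].
    apply is_lim_seq_ext with (fun i => picard (i + j) t).
    + intros; now rewrite Nat.add_comm.
    + apply (is_lim_seq_incr_n (fun i => picard i t)), Hphi.
  - apply is_lim_seq_const. }
assert (Hlip : forall s t, Rabs (phi s - phi t) <= C * Rabs (s - t)).
{ intros s t.
  apply (is_lim_seq_le (fun i => Rabs (picard i s - picard i t)) (fun _ => C * Rabs (s - t))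
    (Rabs (phi s - phi t)) (C * Rabs (s - t))).
  - intros; apply picard_lipschitz.
  - apply (is_lim_seq_abs _ (phi s - phi t)), is_lim_seq_minus'; apply Hphi.
  - apply is_lim_seq_const. }
assert (Hcont : forall t, continuous phi t).
{ intros t; apply continuity_pt_filterlim; intros eps Heps.
  exists (eps / (C + 1)); split.
  - apply Rdiv_lt_0_compat; lra.
  - intros x [_ Hx]; simpl in *; unfold Rdist in *.
    eapply Rle_lt_trans; [apply Hlip |].
    apply Rlt_div_r in Hx; [| lra].
    pose proof (Rabs_pos (x - t)); lra. }
assert (Hint : forall t, phi t = p + RInt (rhs phi) 0 t).
{ intros t.
  assert (Hex : forall f b, (forall s, continuous f s) -> ex_RInt (rhs f) 0 b).
  { intros; apply (ex_RInt_continuous (rhs f)); intros; now apply rhs_continuous. }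
  (* The weighted bound on [phi - picard j] passes through the integral, so [picard (S j) t] also
     tends to the right side of the integral equation. *)
  assert (Hl2 : is_lim_seq (fun j => picard (S j) t) (p + RInt (rhs phi) 0 t)).
  { apply is_lim_seq_spec; intros eps.
    specialize (Hgeom t); apply is_lim_seq_spec in Hgeom.
    destruct (Hgeom eps) as [N HN]; exists N; intros j Hj.
    specialize (HN j Hj); rewrite Rminus_0_r in HN.
    eapply Rle_lt_trans; [| eapply Rle_lt_trans; [apply Rle_abs | exact HN]].
    replace (picard (S j) t - (p + RInt (rhs phi) 0 t)) with
      (RInt (fun s => rhs (picard j) s - rhs phi s) 0 t).
    2: { rewrite (RInt_minus (rhs (picard j)) (rhs phi)).
         - unfold minus, plus, opp; simpl; ring.
         - apply Hex, picard_continuous.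
         - now apply Hex. }
    apply Rle_trans with ((2 * C * (/ 2) ^ j * L) / (2 * L) * exp (2 * L * Rabs t)).
    - apply RInt_exp_bound; [lra | |].
      + intros s; apply (continuous_minus (rhs (picard j)) (rhs phi));
          apply rhs_continuous; [apply picard_continuous | apply Hcont].
      + intros s; unfold rhs.
        replace (a + 2 * mu * cos s - k * sin (picard j s) - (a + 2 * mu * cos s - k * sin (phi s)))
          with (k * (sin (phi s) - sin (picard j s))) by ring.
        rewrite Rabs_mult.
        pose proof (sin_lipschitz (phi s) (picard j s)); specialize (Happ j s).
        assert (Rabs k <= L) by (unfold L; lra).
        pose proof (Rabs_pos (sin (phi s) - sin (picard j s))).
        pose proof (Rabs_pos k).
        replace (2 * C * (/ 2) ^ j * L * exp (2 * L * Rabs s))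
          with (L * (2 * C * (/ 2) ^ j * exp (2 * L * Rabs s))) by ring.
        apply Rmult_le_compat; lra.
    - assert (0 <= C * (/ 2) ^ j * exp (2 * L * Rabs t)).
      { repeat apply Rmult_le_pos; try lra; [apply Rlt_le, Hpow | apply Rlt_le, exp_pos]. }
      replace (2 * C * (/ 2) ^ j * L / (2 * L)) with (C * (/ 2) ^ j) by (field; lra).
      lra. }
  apply is_lim_seq_unique in Hl2.
  assert (Hl1 : is_lim_seq (fun j => picard (S j) t) (phi t)).
  { apply (is_lim_seq_incr_1 (fun j => picard j t)), Hphi. }
  apply is_lim_seq_unique in Hl1; rewrite Hl1 in Hl2; now injection Hl2. }
exists phi; split.
- intros t; apply (is_derive_ext (fun t => p + RInt (rhs phi) 0 t)).
  + intros; symmetry; apply Hint.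
  + apply (rhs_RInt_derive phi), Hcont.
- rewrite Hint, RInt_point; unfold zero; simpl; ring.
Qed.

End Picard.

(** Choosing one orbit by epsilon makes the solution a function of its parameters, to which the
    intermediate value theorem can be applied. *)
Definition flow (a mu k p : R) : R -> R :=
  epsilon (inhabits (fun _ => 0)) (fun phi => is_orbit a mu k phi /\ phi 0 = p).

Lemma flow_spec (a mu k p : R) : is_orbit a mu k (flow a mu k p) /\ flow a mu k p 0 = p.
Proof.
exact (epsilon_spec (inhabits (fun _ => 0)) (fun phi => is_orbit a mu k phi /\ phi 0 = p)
  (orbit_exists_aux a mu k p)).
Qed.

Lemma flow_orbit (a mu k p : R) : is_orbit a mu k (flow a mu k p).
Proof. apply flow_spec. Qed.

Lemma flow_0 (a mu k p : R) : flow a mu k p 0 = p.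
Proof. apply flow_spec. Qed.

(** * Dependence on parameters, uniqueness and order of orbits *)

Lemma orbit_dependence (a mu k mu' k' : R) (phi psi : R -> R) (s t : R) :
  is_orbit a mu k phi -> is_orbit a mu' k' psi -> phi s = psi s -> s <= t ->
  Rabs (phi t - psi t) <=
    (2 * Rabs (mu - mu') + Rabs (k - k')) * exp ((Rabs k + 1) * (t - s)).
Proof.
intros Hphi Hpsi H0 Hst.
set (eta := 2 * Rabs (mu - mu') + Rabs (k - k')).
assert (Heta : 0 <= eta) by (unfold eta; pose proof (Rabs_pos (mu - mu')); pose proof (Rabs_pos (k - k')); lra).
pose (w := fun x => phi x - psi x).
pose (dw := fun x => 2 * (mu - mu') * cos x - k * (sin (phi x) - sin (psi x)) - (k - k') * sin (psi x)).
assert (Hw : forall x, is_derive w x (dw x)).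
{ intros x; eapply is_derive_value.
  - apply (is_derive_minus phi psi); [apply Hphi | apply Hpsi].
  - unfold minus, plus, opp, dw; simpl; ring. }
assert (Hdw : forall x, Rabs (dw x) <= eta + Rabs k * Rabs (w x)).
{ intros x; unfold dw, eta, Rminus at 1 2.
  eapply Rle_trans; [apply Rabs_triang |].
  eapply Rle_trans; [apply Rplus_le_compat_r, Rabs_triang |].
  rewrite !Rabs_Ropp, !Rabs_mult, (Rabs_right 2) by lra.
  pose proof (sin_lipschitz (phi x) (psi x)).
  assert (Rabs (cos x) <= 1) by (apply Rabs_le, COS_bound).
  assert (Rabs (sin (psi x)) <= 1) by (apply Rabs_le, SIN_bound).
  pose proof (Rabs_pos (mu - mu')); pose proof (Rabs_pos (k - k')); pose proof (Rabs_pos k).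
  unfold w; nra. }
(* Adding the constant [eta * eta] makes the inequality homogeneous, as Gronwall requires: [2 |w|
   (eta + |k| |w|) <= (2 |k| + 2) (w^2 + eta^2)]. *)
assert (H : w t * w t + eta * eta <= (w s * w s + eta * eta) * exp ((2 * Rabs k + 2) * (t - s))).
{ apply (gronwall (fun x => w x * w x + eta * eta) (fun x => 2 * w x * dw x)); trivial.
  - intros x; eapply is_derive_value.
    + apply (is_derive_plus (fun x => w x * w x) (fun _ => eta * eta)).
      * apply (is_derive_mult w w); [apply Hw | apply Hw | intros; apply Rmult_comm].
      * apply is_derive_const.
    + unfold plus, mult, zero; simpl; ring.
  - intros x.
    assert (H1 : 2 * w x * dw x <= 2 * (Rabs (w x) * Rabs (dw x))).
    { rewrite <- Rabs_mult; pose proof (Rle_abs (w x * dw x)); lra. }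
    assert (H2 : w x * w x = Rabs (w x) * Rabs (w x)) by exact (Rsqr_abs (w x)).
    rewrite H2; specialize (Hdw x); pose proof (Rabs_pos (w x)); pose proof (Rabs_pos k).
    assert (Rabs (w x) * Rabs (dw x) <= Rabs (w x) * (eta + Rabs k * Rabs (w x))).
    { apply Rmult_le_compat_l; trivial. }
    pose proof (Rle_0_sqr (Rabs (w x) - eta)) as Hq; unfold Rsqr in Hq.
    assert (0 <= Rabs k * (eta * eta)) by (apply Rmult_le_pos; [trivial | apply Rle_0_sqr]).
    assert (0 <= Rabs (w x) * Rabs (w x)) by apply Rle_0_sqr.
    assert (0 <= eta * eta) by apply Rle_0_sqr.
    lra. }
assert (Hws : w s = 0) by (unfold w; lra).
rewrite Hws in H.
replace ((2 * Rabs k + 2) * (t - s)) with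
  ((Rabs k + 1) * (t - s) + (Rabs k + 1) * (t - s)) in H by ring.
rewrite exp_plus in H.
fold (w t); set (e := exp ((Rabs k + 1) * (t - s))) in *.
assert (0 < e) by apply exp_pos.
apply Rsqr_incr_0_var; [| apply Rmult_le_pos; lra].
rewrite <- Rsqr_abs; unfold Rsqr; nra.
Qed.

Lemma orbit_unique (a mu k : R) (phi psi : R -> R) (s t : R) :
  is_orbit a mu k phi -> is_orbit a mu k psi -> phi s = psi s -> s <= t -> phi t = psi t.
Proof.
intros Hphi Hpsi H0 Hst.
pose proof (orbit_dependence a mu k mu k phi psi s t Hphi Hpsi H0 Hst) as H.
rewrite !Rminus_diag, Rabs_R0 in H.
pose proof (Rabs_pos (phi t - psi t)).
assert (Rabs (phi t - psi t) = 0) by lra.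
destruct (Req_dec (phi t - psi t) 0) as [E | E]; [lra |].
now apply Rabs_no_R0 in E.
Qed.

Lemma orbit_continuous (a mu k : R) (phi : R -> R) (t : R) :
  is_orbit a mu k phi -> continuous phi t.
Proof. intros H; eapply is_derive_continuous, H. Qed.

(** If the order were reversed at [t], the orbits would meet at an intermediate time and coincide
    afterwards. *)
Lemma orbit_le (a mu k : R) (phi psi : R -> R) (s t : R) :
  is_orbit a mu k phi -> is_orbit a mu k psi -> phi s <= psi s -> s <= t -> phi t <= psi t.
Proof.
intros Hphi Hpsi H0 Hst.
destruct (Rle_lt_dec (phi t) (psi t)) as [H | H]; [trivial | exfalso].
destruct (IVT_gen (fun x => psi x - phi x) s t 0) as [c [Hc1 Hc2]].
- intros x; apply continuity_pt_filterlim.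
  apply (continuous_minus psi phi); eapply orbit_continuous; eassumption.
- rewrite Rmin_right, Rmax_left; lra.
- rewrite Rmin_left, Rmax_right in Hc1 by trivial.
  rewrite (orbit_unique a mu k phi psi c t) in H; trivial; lra.
Qed.

(** * Integer translates, periods and the rotation number *)

Lemma sin_shift (x : R) (n : Z) : sin (x + 2 * PI * IZR n) = sin x.
Proof.
destruct (Z_le_gt_dec 0 n) as [Hn | Hn].
- rewrite <- (Z2Nat.id n), <- INR_IZR_INZ by trivial.
  replace (x + 2 * PI * INR (Z.to_nat n)) with (x + 2 * INR (Z.to_nat n) * PI) by ring.
  apply sin_period.
- replace x with (x + 2 * PI * IZR n + 2 * INR (Z.to_nat (- n)) * PI) at 2.
  + symmetry; apply sin_period.
  + rewrite INR_IZR_INZ, Z2Nat.id, opp_IZR by lia; ring.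
Qed.

Lemma orbit_translate (a mu k : R) (phi : R -> R) (n : Z) :
  is_orbit a mu k phi -> is_orbit a mu k (fun t => phi t + 2 * PI * IZR n).
Proof.
intros H t; eapply is_derive_value.
- apply (is_derive_plus phi (fun _ => 2 * PI * IZR n)); [apply H | apply is_derive_const].
- rewrite sin_shift; unfold plus, zero; simpl; ring.
Qed.

Lemma orbit_time_shift (a mu k : R) (phi : R -> R) (j : nat) :
  is_orbit a mu k phi -> is_orbit a mu k (fun t => phi (t + 2 * PI * INR j)).
Proof.
intros H t; eapply is_derive_value.
- apply (is_derive_comp phi (fun t => t + 2 * PI * INR j)); [apply H |].
  auto_derive; [trivial | reflexivity].
- unfold scal; simpl; unfold mult; simpl.
  replace (t + 2 * PI * INR j) with (t + 2 * INR j * PI) by ring.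
  rewrite cos_period; ring.
Qed.

(** Shifting time by [j] periods and shifting the phase by [2 * PI * s * j] give two orbits with the
    same value at 0, so they agree one period later. *)
Lemma orbit_iterate (a mu k : R) (phi : R -> R) (s : Z) (j : nat) :
  is_orbit a mu k phi -> phi (2 * PI) = phi 0 + 2 * PI * IZR s ->
  phi (2 * PI * INR j) = phi 0 + 2 * PI * IZR s * INR j.
Proof.
intros H Hs; induction j as [|j IH].
- simpl; rewrite !Rmult_0_r, Rplus_0_r; reflexivity.
- pose proof PI_RGT_0.
  rewrite S_INR.
  pose proof (orbit_unique a mu k _ _ 0 (2 * PI) (orbit_time_shift _ _ _ _ j H)
    (orbit_translate _ _ _ _ (s * Z.of_nat j) H)) as E; simpl in E.
  rewrite mult_IZR, <- INR_IZR_INZ, Rplus_0_l in E.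
  replace (2 * PI * (INR j + 1)) with (2 * PI + 2 * PI * INR j) by ring.
  rewrite E; [rewrite Hs; ring | rewrite IH; ring | lra].
Qed.

Lemma orbit_between (a mu k : R) (phi psi : R -> R) (m : Z) (t : R) :
  is_orbit a mu k phi -> is_orbit a mu k psi -> 0 <= t ->
  phi 0 + 2 * PI * IZR m <= psi 0 <= phi 0 + 2 * PI * (IZR m + 1) ->
  phi t + 2 * PI * IZR m <= psi t <= phi t + 2 * PI * (IZR m + 1).
Proof.
intros H1 H2 Ht [H3 H4]; split.
- apply (orbit_le a mu k (fun t => phi t + 2 * PI * IZR m) psi 0 t); trivial.
  now apply orbit_translate.
- rewrite <- plus_IZR in *.
  apply (orbit_le a mu k psi (fun t => phi t + 2 * PI * IZR (m + 1)) 0 t); trivial.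
  now apply orbit_translate.
Qed.

Lemma floor_2PI (x : R) : exists m : Z, 2 * PI * IZR m <= x <= 2 * PI * (IZR m + 1).
Proof.
pose proof PI_RGT_0.
destruct (archimed (x / (2 * PI))) as [H1 H2].
exists (up (x / (2 * PI)) - 1)%Z; rewrite minus_IZR.
replace x with (2 * PI * (x / (2 * PI))) at 2 3 by (field; lra).
split; apply Rmult_le_compat_l; lra.
Qed.

(** The orbit [psi] stays between two consecutive translates of [phi], whose values at multiples of
    the period are known exactly; the gap [2 * PI] disappears in the quotient. *)
Lemma orbit_rotation (a mu k : R) (phi psi : R -> R) (s : Z) :
  is_orbit a mu k phi -> phi (2 * PI) = phi 0 + 2 * PI * IZR s -> is_orbit a mu k psi ->
  is_lim_seq (fun j : nat => psi (2 * PI * INR j) / (2 * PI * INR j)) (IZR s).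
Proof.
intros Hphi Hs Hpsi; pose proof PI_RGT_0 as HPI.
destruct (floor_2PI (psi 0 - phi 0)) as [m Hm].
set (c := phi 0 + 2 * PI * IZR m).
assert (Hb : forall j : nat, (0 < j)%nat ->
  IZR s + c / (2 * PI) * / INR j <= psi (2 * PI * INR j) / (2 * PI * INR j)
    <= IZR s + (c + 2 * PI) / (2 * PI) * / INR j).
{ intros j Hj; assert (Hj' : 0 < INR j) by now apply lt_0_INR.
  assert (0 < 2 * PI * INR j) by (apply Rmult_lt_0_compat; lra).
  destruct (orbit_between a mu k phi psi m (2 * PI * INR j)) as [H1 H2]; trivial; [lra | lra |].
  rewrite (orbit_iterate a mu k phi s j) in H1, H2 by trivial.
  split.
  - apply Rle_div_r; trivial.
    replace ((IZR s + c / (2 * PI) * / INR j) * (2 * PI * INR j))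
      with (c + 2 * PI * IZR s * INR j) by (field; lra).
    unfold c; lra.
  - apply Rle_div_l; trivial.
    replace ((IZR s + (c + 2 * PI) / (2 * PI) * / INR j) * (2 * PI * INR j))
      with (c + 2 * PI + 2 * PI * IZR s * INR j) by (field; lra).
    unfold c; lra. }
assert (Hl : forall d : R, is_lim_seq (fun j => IZR s + d * / INR j) (IZR s)).
{ intros d; replace (Finite (IZR s)) with (Finite (IZR s + d * 0)) by (f_equal; ring).
  apply is_lim_seq_plus'; [apply is_lim_seq_const |].
  apply (is_lim_seq_scal_l (fun j => / INR j) d 0).
  apply (is_lim_seq_inv _ _ is_lim_seq_INR); discriminate. }
apply (is_lim_seq_le_le_loc (fun j => IZR s + c / (2 * PI) * / INR j) _
  (fun j => IZR s + (c + 2 * PI) / (2 * PI) * / INR j)); [| apply Hl | apply Hl].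
exists 1%nat; intros j Hj; apply Hb; lia.
Qed.

(** * The Perron-Frobenius eigenvector *)

(** A positive eigenvector, for the eigenvalue [mu], of the [l] by [l] matrix adding a weighted
    shift and [n] times the reversal of indices. The convention [b l = 0] closes the last row. *)
Definition pf_vector (l : nat) (n mu : R) (b : nat -> R) : Prop :=
  (forall k, (k < l)%nat -> 0 < b k) /\ b l = 0 /\
  forall m, (m < l)%nat -> mu * b m = INR (S m) * b (S m) + n * b (l - 1 - m)%nat.

(* Eliminating the reversed index from [pf_vector] gives a three-term recursion;
   the pair is [(b_(k-1), b_k)], started from [(0, 1)]. *)
Fixpoint pf_pair (L n mu : R) (k : nat) : R * R :=
  match k with
  | O => (0, 1)
  | S k => let (x, y) := pf_pair L n mu k in
      (y, ((INR k * (L - INR k) + mu * mu - n * n) * y - mu * (L - INR k) * x)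
          / (mu * INR (S k)))
  end.

Definition pf_prev (L n mu : R) (k : nat) : R := fst (pf_pair L n mu k).
Definition pf_coef (L n mu : R) (k : nat) : R := snd (pf_pair L n mu k).

Lemma pf_prev_0 (L n mu : R) : pf_prev L n mu 0 = 0.
Proof. reflexivity. Qed.

Lemma pf_coef_0 (L n mu : R) : pf_coef L n mu 0 = 1.
Proof. reflexivity. Qed.

Lemma pf_prev_S (L n mu : R) (k : nat) : pf_prev L n mu (S k) = pf_coef L n mu k.
Proof. unfold pf_prev, pf_coef; simpl; now destruct (pf_pair L n mu k). Qed.

Lemma pf_coef_S (L n mu : R) (k : nat) : mu <> 0 ->
  mu * INR (S k) * pf_coef L n mu (S k) =
  (INR k * (L - INR k) + mu * mu - n * n) * pf_coef L n mu k
  - mu * (L - INR k) * pf_prev L n mu k.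
Proof.
intros Hmu; unfold pf_prev, pf_coef; cbn [pf_pair].
destruct (pf_pair L n mu k) as [x y]; cbn [fst snd].
field; split; [apply not_0_INR; lia | trivial].
Qed.

Lemma pf_pair_continuous (L n mu : R) (k : nat) : mu <> 0 ->
  continuous (fun m => pf_prev L n m k) mu /\ continuous (fun m => pf_coef L n m k) mu.
Proof.
intros Hmu; induction k as [|k [IH1 IH2]].
- split; apply continuous_const.
- split.
  + apply (continuous_ext (fun m => pf_coef L n m k)); trivial.
    intros; symmetry; apply pf_prev_S.
  + apply (continuous_ext (fun m =>
      ((INR k * (L - INR k) + m * m - n * n) * pf_coef L n m k
       - m * (L - INR k) * pf_prev L n m k) * / (m * INR (S k)))).
    { intros m; unfold pf_prev, pf_coef; cbn [pf_pair].
      now destruct (pf_pair L n m k). }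
    apply (continuous_mult (fun m => (INR k * (L - INR k) + m * m - n * n) * pf_coef L n m k
       - m * (L - INR k) * pf_prev L n m k) (fun m => / (m * INR (S k)))).
    * apply (continuous_minus (fun m => (INR k * (L - INR k) + m * m - n * n) * pf_coef L n m k)
        (fun m => m * (L - INR k) * pf_prev L n m k)).
      -- apply (continuous_mult (fun m => INR k * (L - INR k) + m * m - n * n)); trivial.
         apply (ex_derive_continuous (fun m => INR k * (L - INR k) + m * m - n * n)).
         auto_derive; trivial.
      -- apply (continuous_mult (fun m => m * (L - INR k))); trivial.
         apply (ex_derive_continuous (fun m => m * (L - INR k))).
         auto_derive; trivial.
    * apply (ex_derive_continuous (fun m => / (m * INR (S k)))).
      auto_derive; apply Rmult_integral_contrapositive_currified; trivial.
      apply (not_0_INR (S k)); lia.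
Qed.

(** Bounds the set whose supremum is taken in [pf_critical]: for such [mu] the terms are
    nondecreasing up to index [l]. *)
Lemma pf_coef_large (l : nat) (n mu : R) : 0 < n -> n + INR l + 2 <= mu ->
  forall k, (k <= l)%nat ->
  0 <= pf_prev (INR l) n mu k <= pf_coef (INR l) n mu k /\ 0 < pf_coef (INR l) n mu k.
Proof.
intros Hn Hmu k; pose proof (pos_INR l) as Hl.
induction k as [|k IH]; intros Hk.
- unfold pf_prev, pf_coef; simpl; lra.
- destruct IH as [[H1 H2] H3]; [lia |].
  rewrite pf_prev_S.
  assert (E := pf_coef_S (INR l) n mu k ltac:(lra)).
  assert (Hkl : INR k + 1 <= INR l) by (rewrite <- S_INR; now apply le_INR).
  pose proof (pos_INR k) as Hk0.
  rewrite S_INR in E.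
  set (x := pf_prev (INR l) n mu k) in *; set (y := pf_coef (INR l) n mu k) in *.
  set (z := pf_coef (INR l) n mu (S k)) in *.
  assert (Hy : y <= z).
  { apply Rmult_le_reg_l with (mu * (INR k + 1)); [nra |].
    rewrite E.
    assert (0 <= INR k * (INR l - INR k) * y) by (repeat apply Rmult_le_pos; lra).
    assert (mu * (INR l - INR k) * x <= mu * (INR l - INR k) * y)
      by (apply Rmult_le_compat_l; [apply Rmult_le_pos |]; lra).
    (* Since [mu - n >= l + 2], [mu^2 - n^2] dominates [mu * (l + 1)], the sum of the loss
       [mu * (l - k)] and the needed factor [mu * (k + 1)]. *)
    assert (mu * (INR l + 1) * y <= (mu * mu - n * n) * y).
    { apply Rmult_le_compat_r; [lra | nra]. }
    nra. }
  lra.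
Qed.

Lemma positive_neighbourhood (f : nat -> R -> R) (x : R) (l : nat) :
  (forall k, (k <= l)%nat -> continuous (f k) x /\ 0 < f k x) ->
  exists d : posreal, forall y, Rabs (y - x) < d -> forall k, (k <= l)%nat -> 0 < f k y.
Proof.
intros H.
assert (Hl : locally x (fun y => forall k, (k <= l)%nat -> 0 < f k y)).
{ induction l as [|l IH].
  - destruct (H 0%nat (le_n _)) as [H1 H2].
    apply filter_imp with (fun y => 0 < f 0%nat y).
    + intros y Hy k Hk; now replace k with 0%nat by lia.
    + apply (H1 (fun v => 0 < v)), (open_gt 0); exact H2.
  - destruct (H (S l) (le_n _)) as [H1 H2].
    apply filter_imp with (fun y => (forall k, (k <= l)%nat -> 0 < f k y) /\ 0 < f (S l) y).
    + intros y [Hy1 Hy2] k Hk; destruct (Nat.eq_dec k (S l)) as [-> | Hn]; trivial.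
      apply Hy1; lia.
    + apply filter_and.
      * apply IH; intros; apply H; lia.
      * apply (H1 (fun v => 0 < v)), (open_gt 0); exact H2. }
destruct Hl as [d Hd]; exists d; intros y Hy; exact (Hd y Hy).
Qed.

(* The infimum of the [mu] beyond which all [b_k], [k <= l], are positive: two
   consecutive terms cannot vanish, so only [b_l] can vanish there. *)
Lemma pf_critical (l : nat) (n : R) : (1 <= l)%nat -> 0 < n ->
  exists mu, n <= mu /\ pf_coef (INR l) n mu l = 0 /\
    forall k, (k < l)%nat -> 0 < pf_coef (INR l) n mu k.
Proof.
intros Hl Hn.
pose (E := fun m => 0 < m /\ exists k, (k <= l)%nat /\ pf_coef (INR l) n m k <= 0).
(* At [mu = n] the recursion gives [b_1 = 0], so the set is not empty. *)
assert (HEn : E n).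
{ split; trivial; exists 1%nat; split; trivial.
  pose proof (pf_coef_S (INR l) n n 0 ltac:(lra)) as H.
  rewrite pf_prev_0, pf_coef_0 in H; simpl in H.
  apply Rmult_le_reg_l with n; trivial; lra. }
destruct (completeness E) as [mu [Hub Hlub]].
- exists (n + INR l + 2); intros m [Hm [k [Hk Hk']]].
  destruct (Rle_dec m (n + INR l + 2)) as [H | H]; trivial.
  destruct (pf_coef_large l n m Hn ltac:(lra) k Hk); lra.
- now exists n.
- assert (Hmu : n <= mu) by now apply Hub.
  assert (Hc : forall k, continuous (fun m => pf_coef (INR l) n m k) mu)
    by (intros; apply pf_pair_continuous; lra).
  (* A negative term would stay negative slightly to the right of the supremum. *)
  assert (Hpos : forall k, (k <= l)%nat -> 0 <= pf_coef (INR l) n mu k).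
  { intros k Hk; destruct (Rle_lt_dec 0 (pf_coef (INR l) n mu k)) as [H | H]; trivial.
    destruct (Hc k (fun v => v < 0)) as [d Hd]; [apply (open_lt 0); exact H |].
    assert (Hd' : pf_coef (INR l) n (mu + d / 2) k < 0).
    { apply Hd; change (Rabs (mu + d / 2 - mu) < d).
      pose proof (cond_pos d); rewrite Rabs_right; lra. }
    pose proof (cond_pos d).
    assert (mu + d / 2 <= mu); [| lra].
    apply Hub; split; [lra |]; exists k; split; [trivial | lra]. }
  (* If [b_(k+1)] vanished with [k + 1 < l], the recursion would make [b_(k+2)] a negative multiple
     of [b_k]. *)
  assert (Hlt : forall k, (k < l)%nat -> 0 < pf_coef (INR l) n mu k).
  { induction k as [|k IH]; intros Hk.
    - unfold pf_coef; simpl; lra.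
    - destruct (Hpos (S k) ltac:(lia)) as [H | H]; trivial.
      specialize (IH ltac:(lia)); specialize (Hpos (S (S k)) ltac:(lia)).
      pose proof (pf_coef_S (INR l) n mu (S k) ltac:(lra)) as HS.
      rewrite <- H, pf_prev_S, Rmult_0_r, Rminus_0_l in HS.
      assert (0 < mu * (INR l - INR (S k)) * pf_coef (INR l) n mu k).
      { apply lt_INR in Hk; repeat apply Rmult_lt_0_compat; lra. }
      assert (0 <= mu * INR (S (S k)) * pf_coef (INR l) n mu (S (S k))).
      { pose proof (pos_INR (S (S k))); repeat apply Rmult_le_pos; lra. }
      lra. }
  exists mu; split; [trivial | split; [| trivial]].
  destruct (Hpos l (le_n _)) as [H | H]; [exfalso | now symmetry].
  (* If [b_l] were positive too, all terms would be positive near [mu], and [mu - d / 2] would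
     already be an upper bound. *)
  destruct (positive_neighbourhood (fun k m => pf_coef (INR l) n m k) mu l) as [d Hd].
  { intros k Hk; split; [apply Hc |].
    destruct (Nat.eq_dec k l) as [-> | Hk']; [trivial | apply Hlt; lia]. }
  pose proof (cond_pos d).
  assert (mu <= mu - d / 2); [| lra].
  apply Hlub; intros m [Hm [k [Hk Hk']]].
  destruct (Rle_dec m (mu - d / 2)) as [Hm' | Hm']; trivial.
  assert (m <= mu) by (apply Hub; split; [trivial | now exists k]).
  assert (0 < pf_coef (INR l) n m k); [| lra].
  apply Hd; trivial; rewrite Rabs_left1; lra.
Qed.

(* Reversal [b |-> (mu b_(l-1-k) - (l-k) b_(l-k))_k] preserves the three-term
   recursion, whose solutions vanishing at index -1 form a line. *)
Lemma pf_reversal (l : nat) (n mu : R) : 0 < mu -> pf_coef (INR l) n mu l = 0 ->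
  forall k, (k <= l)%nat ->
  mu * pf_prev (INR l) n mu (l - k) - (INR l - INR k) * pf_coef (INR l) n mu (l - k)
  = mu * pf_prev (INR l) n mu l * pf_coef (INR l) n mu k.
Proof.
intros Hmu H0.
set (c := fun k => mu * pf_prev (INR l) n mu (l - k)
                   - (INR l - INR k) * pf_coef (INR l) n mu (l - k)).
assert (Hc0 : c 0%nat = mu * pf_prev (INR l) n mu l * pf_coef (INR l) n mu 0).
{ unfold c; rewrite Nat.sub_0_r, H0; unfold pf_coef at 1; simpl; ring. }
assert (Hc1 : (1 <= l)%nat -> c 1%nat = mu * pf_prev (INR l) n mu l * pf_coef (INR l) n mu 1).
{ intros Hl; unfold c; destruct l as [|j]; [lia |].
  replace (S j - 1)%nat with j by lia.
  rewrite pf_prev_S; apply Rmult_eq_reg_l with (mu * INR 1); [| simpl; nra].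
  pose proof (pf_coef_S (INR (S j)) n mu 0 ltac:(lra)) as E1.
  pose proof (pf_coef_S (INR (S j)) n mu j ltac:(lra)) as E2.
  rewrite H0 in E2.
  rewrite pf_coef_0, pf_prev_0 in E1.
  rewrite !S_INR in *; simpl in E1, E2 |- *.
  nsatz. }
cut (forall k, ((k <= l)%nat -> c k = mu * pf_prev (INR l) n mu l * pf_coef (INR l) n mu k) /\
  ((S k <= l)%nat -> c (S k) = mu * pf_prev (INR l) n mu l * pf_coef (INR l) n mu (S k))).
{ intros H k; apply H. }
induction k as [|k [IH1 IH2]]; [now split |].
split; [trivial |]; intros Hk.
specialize (IH1 ltac:(lia)); specialize (IH2 ltac:(lia)).
apply Rmult_eq_reg_l with (mu * INR (S (S k))).
2: { pose proof (lt_0_INR (S (S k)) ltac:(lia)); nra. }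
pose proof (pf_coef_S (INR l) n mu (S k) ltac:(lra)) as E.
rewrite pf_prev_S in E.
(* It remains to see that the reversed sequence [c] satisfies the recursion itself, which follows
   from the instances for [b] at [j = l - k - 2] and [j + 1]. *)
transitivity ((INR (S k) * (INR l - INR (S k)) + mu * mu - n * n) * c (S k)
  - mu * (INR l - INR (S k)) * c k); [| rewrite IH1, IH2; nsatz].
clear IH1 IH2 E Hc0 Hc1 H0; unfold c; clear c.
destruct (Nat.le_exists_sub (S (S k)) l Hk) as [j [Hj _]].
replace (l - S (S k))%nat with j by lia.
replace (l - S k)%nat with (S j) by lia.
replace (l - k)%nat with (S (S j)) by lia.
pose proof (pf_coef_S (INR l) n mu j ltac:(lra)) as E1.
pose proof (pf_coef_S (INR l) n mu (S j) ltac:(lra)) as E2.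
rewrite !pf_prev_S in *.
assert (EL : INR l = INR j + INR k + 2) by (rewrite Hj, plus_INR, !S_INR; ring).
rewrite EL, !S_INR in *.
nsatz.
Qed.

(** Reversal multiplies the vector by [mu * b_(l-1)]. Its entry [k = l - 1] shows that the square of
    this factor is [n^2], positivity selects [n], and the reversal identity becomes the eigenvector
    equation. *)
Lemma pf_exists (l : nat) (n : R) : (1 <= l)%nat -> 0 < n ->
  exists mu b, n <= mu /\ pf_vector l n mu b.
Proof.
intros Hl Hn; destruct (pf_critical l n Hl Hn) as [mu [Hmu [H0 Hpos]]].
exists mu, (pf_coef (INR l) n mu); split; [trivial |].
split; [trivial | split; [trivial |]].
pose proof (pf_reversal l n mu ltac:(lra) H0) as Hr.
destruct l as [|j]; [lia |].
rewrite pf_prev_S in Hr.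
assert (Hc : mu * pf_coef (INR (S j)) n mu j = n).
{ specialize (Hr j ltac:(lia)); specialize (Hpos j ltac:(lia)).
  replace (S j - j)%nat with 1%nat in Hr by lia.
  pose proof (pf_coef_S (INR (S j)) n mu 0 ltac:(lra)) as E.
  rewrite pf_prev_S in Hr.
  rewrite pf_coef_0 in Hr, E; rewrite pf_prev_0 in E.
  assert (Hd : INR (S j) - INR j = 1) by (rewrite S_INR; ring).
  rewrite Hd in Hr.
  set (y := pf_coef (INR (S j)) n mu j) in *.
  set (z := pf_coef (INR (S j)) n mu 1) in *; change (INR 0) with 0 in E; change (INR 1) with 1 in E.
  assert (H : (mu * y - n) * (mu * y + n) = 0) by nsatz.
  apply Rmult_integral in H; destruct H as [H | H]; [lra |].
  assert (0 < mu * y) by (apply Rmult_lt_0_compat; lra); lra. }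
intros m Hm.
specialize (Hr (S j - 1 - m)%nat ltac:(lia)).
rewrite Hc in Hr; rewrite <- Hr.
replace (S j - (S j - 1 - m))%nat with (S m) by lia.
rewrite pf_prev_S.
replace (INR (S j) - INR (S j - 1 - m)) with (INR (S m)); [ring |].
rewrite <- minus_INR by lia; f_equal; lia.
Qed.

(** * Comparison, bound and continuity of the eigenvalue *)

Lemma finite_argmax (f : nat -> R) (l : nat) :
  exists k, (k <= l)%nat /\ forall j, (j <= l)%nat -> f j <= f k.
Proof.
induction l as [|l [k [Hk H]]].
- exists 0%nat; split; [lia |]; intros j Hj; replace j with 0%nat by lia; lra.
- destruct (Rle_dec (f k) (f (S l))) as [Hf | Hf].
  + exists (S l); split; [lia |]; intros j Hj.
    destruct (Nat.eq_dec j (S l)) as [-> | Hn]; [lra |].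
    specialize (H j ltac:(lia)); lra.
  + exists k; split; [lia |]; intros j Hj.
    destruct (Nat.eq_dec j (S l)) as [-> | Hn]; [lra |].
    apply H; lia.
Qed.

(* Collatz-Wielandt: compare at the index maximizing [b'_k / b_k]. *)
Lemma pf_compare (l : nat) (n mu mu' : R) (b b' : nat -> R) :
  (1 <= l)%nat -> 0 <= n -> pf_vector l n mu b ->
  (forall k, (k < l)%nat -> 0 < b' k) -> b' l = 0 ->
  (forall m, (m < l)%nat -> mu' * b' m <= INR (S m) * b' (S m) + n * b' (l - 1 - m)%nat) ->
  mu' <= mu.
Proof.
intros Hl Hn [Hb [Hbl Hm]] Hb' Hbl' Hm'.
destruct (finite_argmax (fun k => b' k / b k) (l - 1)) as [k [Hk H]].
assert (Hr : forall j, (j <= l)%nat -> b' j * b k <= b' k * b j).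
{ intros j Hj; destruct (Nat.eq_dec j l) as [-> | Hn'].
  - rewrite Hbl, Hbl'; lra.
  - specialize (H j ltac:(lia)).
    pose proof (Hb j ltac:(lia)); pose proof (Hb k ltac:(lia)).
    apply Rmult_le_compat_r with (r := b j * b k) in H; [| nra].
    replace (b' j / b j * (b j * b k)) with (b' j * b k) in H by (field; lra).
    replace (b' k / b k * (b j * b k)) with (b' k * b j) in H by (field; lra).
    trivial. }
specialize (Hm k ltac:(lia)); specialize (Hm' k ltac:(lia)).
pose proof (Hb k ltac:(lia)) as Hk1; pose proof (Hb' k ltac:(lia)) as Hk2.
pose proof (Hr (S k) ltac:(lia)) as H1.
pose proof (Hr (l - 1 - k)%nat ltac:(lia)) as H2.
apply Rmult_le_reg_r with (b' k * b k); [nra |].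
apply Rle_trans with ((INR (S k) * b' (S k) + n * b' (l - 1 - k)%nat) * b k).
- nra.
- replace (mu * (b' k * b k)) with ((mu * b k) * b' k) by ring; rewrite Hm.
  pose proof (pos_INR (S k)).
  assert (INR (S k) * (b' (S k) * b k) <= INR (S k) * (b' k * b (S k))) by now apply Rmult_le_compat_l.
  assert (n * (b' (l - 1 - k)%nat * b k) <= n * (b' k * b (l - 1 - k)%nat)) by now apply Rmult_le_compat_l.
  lra.
Qed.

(** Each vector is a subsolution for the other parameter: raising [n'] to [n] enlarges the right
    side for [b'], and scaling the equation of [b] by [n' / n <= 1] turns [n] into [n'] and shrinks
    the shift term. *)
Lemma pf_monotone (l : nat) (n n' mu mu' : R) (b b' : nat -> R) :
  (1 <= l)%nat -> 0 < n' <= n -> pf_vector l n mu b -> pf_vector l n' mu' b' ->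
  mu' <= mu <= n / n' * mu'.
Proof.
intros Hl Hn Hb Hb'; split.
- destruct Hb' as [H1 [H2 H3]].
  apply (pf_compare l n mu mu' b b'); trivial; [lra |].
  intros m Hm; rewrite H3 by trivial.
  specialize (H1 (l - 1 - m)%nat ltac:(lia)); nra.
- cut (mu * (n' / n) <= mu').
  { intros H; apply Rmult_le_compat_l with (r := n / n') in H; [| apply Rdiv_le_0_compat; lra].
    replace (n / n' * (mu * (n' / n))) with mu in H by (field; lra); trivial. }
  destruct Hb as [H1 [H2 H3]].
  apply (pf_compare l n' mu' (mu * (n' / n)) b' b); trivial; [lra |].
  intros m Hm.
  replace (mu * (n' / n) * b m) with ((n' / n) * (mu * b m)) by (field; lra).
  rewrite H3 by trivial.
  replace (n' / n * (INR (S m) * b (S m) + n * b (l - 1 - m)%nat)) with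
    (n' / n * (INR (S m) * b (S m)) + n' * b (l - 1 - m)%nat) by (field; lra).
  apply Rplus_le_compat_r.
  assert (n' / n <= 1) by (apply Rle_div_l; lra).
  assert (0 <= INR (S m) * b (S m)).
  { apply Rmult_le_pos; [apply pos_INR |].
    destruct (Nat.eq_dec (S m) l) as [-> | Hn']; [lra |].
    apply Rlt_le, H1; lia. }
  nra.
Qed.

Lemma sum_f_R0_reverse (f : nat -> R) (N : nat) :
  sum_f_R0 (fun i => f (N - i)%nat) N = sum_f_R0 f N.
Proof.
induction N as [|N IH]; [reflexivity |].
rewrite decomp_sum by lia; rewrite Nat.sub_0_r; simpl pred.
rewrite (sum_eq _ (fun i => f (N - i)%nat)) by reflexivity.
rewrite IH; simpl; ring.
Qed.

Lemma sum_f_R0_shift_weight (f : nat -> R) (N : nat) :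
  sum_f_R0 (fun m => INR (S m) * f (S m)) N = sum_f_R0 (fun m => INR m * f m) N + INR (S N) * f (S N).
Proof.
induction N as [|N IH]; [simpl; ring |].
rewrite !tech5, IH; ring.
Qed.

Lemma sum_f_R0_pos (f : nat -> R) (N : nat) :
  (forall m, (m <= N)%nat -> 0 < f m) -> 0 < sum_f_R0 f N.
Proof.
intros H; induction N as [|N IH]; [apply H; lia |].
rewrite tech5; apply Rplus_lt_0_compat; [apply IH; intros; apply H; lia | apply H; lia].
Qed.

(* With weights [1 / C(N,m)], the shift [b |-> ((m+1) b_(m+1))_m] has
   numerical range bounded by [N / 2] (it is a lowering operator of spin
   [N / 2]) and the reversal is an isometry. *)
Lemma pf_value_bound (N : nat) (n mu : R) (b : nat -> R) :
  0 <= n -> pf_vector (S N) n mu b -> mu <= n + INR N / 2.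
Proof.
intros Hn [Hb [Hbl Hm]].
pose (w := fun m => INR (fact m * fact (N - m))).
assert (Hw : forall m, 0 < w m).
{ intros m; apply lt_0_INR; pose proof (lt_O_fact m); pose proof (lt_O_fact (N - m)); nia. }
assert (Hwr : forall m, (m <= N)%nat -> w (N - m)%nat = w m).
{ intros m Hm'; unfold w; f_equal; replace (N - (N - m))%nat with m by lia; ring. }
assert (HwS : forall m, (m < N)%nat -> INR (S m) * w m = (INR N - INR m) * w (S m)).
{ intros m Hm'; unfold w; rewrite <- minus_INR, <- !mult_INR by lia; f_equal.
  replace (N - m)%nat with (S (N - S m)) by lia; simpl; ring. }
pose (f := fun m => w m * (b m * b m)).
assert (Hq : 0 < sum_f_R0 f N).
{ apply sum_f_R0_pos; intros m Hm'; pose proof (Hb m ltac:(lia)); pose proof (Hw m).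
  repeat apply Rmult_lt_0_compat; trivial. }
(* The products [b_m b_(m+1)] and [b_m b_(N-m)] are bounded by half sums of weighted squares; after
   summation the terms [INR m * f m] telescope up to [f (S N) = 0]. *)
assert (Hle : sum_f_R0 (fun m => f m * mu) N <=
  sum_f_R0 (fun m => (f m * INR N - INR m * f m + INR (S m) * f (S m)) * / 2
                     + (f m + f (N - m)%nat) * (n / 2)) N).
{ apply sum_Rle; intros m Hm'.
  replace (f m * mu) with (w m * b m * (mu * b m)) by (unfold f; ring).
  rewrite Hm by lia; replace (S N - 1 - m)%nat with (N - m)%nat by lia.
  rewrite Rmult_plus_distr_l; apply Rplus_le_compat.
  - destruct (Nat.eq_dec m N) as [-> | Hne].
    + unfold f; rewrite Hbl; lra.
    + specialize (HwS m ltac:(lia)).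
      assert (Hc : 0 <= w (S m) * ((INR N - INR m) * b m - INR (S m) * b (S m)) ^ 2)
        by (apply Rmult_le_pos; [apply Rlt_le, Hw | apply pow2_ge_0]).
      assert (Hd : 0 < INR (S m)) by (apply lt_0_INR; lia).
      apply Rmult_le_reg_l with (INR (S m)); [lra |].
      unfold f.
      replace (INR (S m) * (w m * b m * (INR (S m) * b (S m)))) with
        ((INR (S m) * w m) * (b m * (INR (S m) * b (S m)))) by ring.
      replace (INR (S m) * ((w m * (b m * b m) * INR N - INR m * (w m * (b m * b m))
        + INR (S m) * (w (S m) * (b (S m) * b (S m)))) * / 2)) with
        (((INR (S m) * w m) * (b m * b m * (INR N - INR m))
        + INR (S m) * INR (S m) * (w (S m) * (b (S m) * b (S m)))) * / 2) by ring.
      rewrite HwS; nra.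
  - unfold f; rewrite (Hwr m) by lia.
    assert (0 <= n * w m * (b m - b (N - m)%nat) ^ 2).
    { apply Rmult_le_pos; [apply Rmult_le_pos; [trivial | apply Rlt_le, Hw] | apply pow2_ge_0]. }
    lra. }
rewrite <- scal_sum, plus_sum, <- !scal_sum, plus_sum, minus_sum, <- scal_sum in Hle.
rewrite (sum_f_R0_shift_weight f), plus_sum, (sum_f_R0_reverse f) in Hle.
replace (f (S N)) with 0 in Hle by (unfold f; rewrite Hbl; ring).
apply Rmult_le_reg_r with (sum_f_R0 f N); lra.
Qed.

(** By [pf_monotone] with equal parameters only one eigenvalue has a positive eigenvector, so for
    [l >= 1] and [n > 0] the choice is the Perron-Frobenius eigenvalue. *)
Definition pf_value (l : nat) (n : R) : R :=
  epsilon (inhabits 0) (fun mu => n <= mu /\ exists b, pf_vector l n mu b).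

Lemma pf_value_spec (l : nat) (n : R) : (1 <= l)%nat -> 0 < n ->
  n <= pf_value l n /\ exists b, pf_vector l n (pf_value l n) b.
Proof.
intros Hl Hn.
apply (epsilon_spec (inhabits 0) (fun mu => n <= mu /\ exists b, pf_vector l n mu b)).
destruct (pf_exists l n Hl Hn) as [mu [b [H1 H2]]]; exists mu; split; [trivial | now exists b].
Qed.

Lemma pf_value_continuous (l : nat) (n : R) : (1 <= l)%nat -> 0 < n ->
  continuous (pf_value l) n.
Proof.
intros Hl Hn.
destruct (pf_value_spec l n Hl Hn) as [Hle [b Hb]].
set (mu := pf_value l n) in *.
apply continuity_pt_filterlim; intros eps Heps.
(* The ratio bounds of [pf_monotone] give [|mux - mu| <= mu |x - n| / min(x, n)], and the first
   entry keeps [x > n / 2]. *)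
exists (Rmin (n / 2) (eps * n / (4 * mu))); split.
{ apply Rmin_pos; [lra |].
  apply Rdiv_lt_0_compat; [apply Rmult_lt_0_compat |]; lra. }
intros x [_ Hx]; simpl in *; unfold Rdist in *; fold mu.
assert (H1 := Rlt_le_trans _ _ _ Hx (Rmin_l _ _)).
assert (H2 := Rlt_le_trans _ _ _ Hx (Rmin_r _ _)).
apply Rlt_div_r in H2; [| lra].
apply Rabs_def2 in H1.
destruct (pf_value_spec l x Hl ltac:(lra)) as [Hlex [bx Hbx]].
set (mux := pf_value l x) in *.
destruct (Rle_dec x n) as [Hxn | Hxn].
- destruct (pf_monotone l n x mu mux b bx) as [H3 H4]; trivial; [lra |].
  rewrite Rabs_left1 in * by lra.
  apply Rmult_le_compat_l with (r := x) in H4; [| lra].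
  replace (x * (n / x * mux)) with (n * mux) in H4 by (field; lra).
  nra.
- destruct (pf_monotone l x n mux mu bx b) as [H3 H4]; trivial; [lra |].
  rewrite Rabs_right in * by lra.
  apply Rmult_le_compat_l with (r := n) in H4; [| lra].
  replace (n * (x / n * mu)) with (x * mu) in H4 by (field; lra).
  nra.
Qed.

(** * The periodic orbit of the polynomial solution *)

(** [trig_cos] and [trig_sin] are the real and imaginary parts, at [z = exp (i t)], of the
    polynomial with coefficients [a]. *)
Definition trig_cos (a : nat -> R) (N : nat) (t : R) : R :=
  sum_f_R0 (fun j => a j * cos (INR j * t)) N.
Definition trig_sin (a : nat -> R) (N : nat) (t : R) : R :=
  sum_f_R0 (fun j => a j * sin (INR j * t)) N.

Lemma is_derive_sum_f_R0 (f df : nat -> R -> R) (N : nat) (t : R) :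
  (forall j, is_derive (f j) t (df j t)) ->
  is_derive (fun t => sum_f_R0 (fun j => f j t) N) t (sum_f_R0 (fun j => df j t) N).
Proof.
intros H; induction N as [|N IH]; [apply H |].
apply (is_derive_plus (fun t => sum_f_R0 (fun j => f j t) N) (f (S N))); trivial.
Qed.

(** For [h j = z^j] this reads [z E'(z) = (-1)^N n z^(N+1) E(1/z) - mu z E(z)]; a general [h] covers
    the real and imaginary parts. *)
Lemma pf_vector_sum (N : nat) (n mu : R) (b h : nat -> R) : pf_vector (S N) n mu b ->
  sum_f_R0 (fun j => INR j * ((-1) ^ j * b j * h j)) N =
  (-1) ^ N * n * sum_f_R0 (fun j => (-1) ^ j * b j * h (S (N - j))) N
  - mu * sum_f_R0 (fun j => (-1) ^ j * b j * h (S j)) N.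
Proof.
intros [_ [Hbl Hm]].
pose proof (sum_f_R0_shift_weight (fun j => (-1) ^ j * b j * h j) N) as H.
simpl in H; rewrite Hbl in H.
transitivity (sum_f_R0 (fun m => INR (S m) * ((-1) ^ S m * b (S m) * h (S m))) N).
{ simpl; rewrite H; ring. }
rewrite <- (sum_f_R0_reverse (fun j => (-1) ^ j * b j * h (S (N - j)))).
rewrite !scal_sum, <- minus_sum; apply sum_eq; intros m Hm'.
specialize (Hm m ltac:(lia)); replace (S N - 1 - m)%nat with (N - m)%nat in Hm by lia.
replace (N - (N - m))%nat with m by lia.
assert (Hs : (-1) ^ (N - m) * (-1) ^ N = (-1) ^ m).
{ replace N with (N - m + m)%nat at 2 by lia.
  rewrite pow_add, <- Rmult_assoc, <- Rpow_mult_distr.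
  replace (-1 * -1) with 1 by ring; rewrite pow1; ring. }
replace ((-1) ^ (N - m) * b (N - m)%nat * h (S m) * ((-1) ^ N * n)) with
  (((-1) ^ (N - m) * (-1) ^ N) * (n * b (N - m)%nat) * h (S m)) by ring.
rewrite Hs.
replace (n * b (N - m)%nat) with (mu * b m - INR (S m) * b (S m)) by (rewrite Hm; ring).
rewrite <- tech_pow_Rmult; ring.
Qed.

Lemma pow_opp1 (N : nat) : (-1) ^ N = 1 \/ (-1) ^ N = -1.
Proof. induction N as [|N [H | H]]; simpl; [lra | rewrite H; lra | rewrite H; lra]. Qed.

Section PeriodicOrbit.
Variables (N : nat) (n mu : R) (b : nat -> R) (phi : R -> R).
Hypothesis n_pos : 0 < n.
Hypothesis pf_b : pf_vector (S N) n mu b.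
Hypothesis phi_orbit : is_orbit (INR (S N)) mu (2 * n) phi.
Hypothesis phi_0 : phi 0 = (-1) ^ N * (PI / 2).

Let a (j : nat) : R := (-1) ^ j * b j.
Let l : R := INR (S N).

Lemma trig_sum_derive (t : R) :
  is_derive (trig_cos a N) t
    (- ((-1) ^ N * n * (sin (l * t) * trig_cos a N t - cos (l * t) * trig_sin a N t)
        - mu * (sin t * trig_cos a N t + cos t * trig_sin a N t))) /\
  is_derive (trig_sin a N) t
    ((-1) ^ N * n * (cos (l * t) * trig_cos a N t + sin (l * t) * trig_sin a N t)
     - mu * (cos t * trig_cos a N t - sin t * trig_sin a N t)).
Proof.
assert (HS : forall j, (j <= N)%nat -> INR (S (N - j)) = l - INR j).
{ intros j Hj; unfold l; rewrite !S_INR, minus_INR by trivial; ring. }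
split.
- eapply is_derive_value.
  + apply (is_derive_sum_f_R0 (fun j t => a j * cos (INR j * t))
      (fun j t => - (INR j * (a j * sin (INR j * t))))).
    intros j; auto_derive; [trivial | ring].
  + transitivity (- sum_f_R0 (fun j => INR j * (a j * sin (INR j * t))) N).
    { transitivity (sum_f_R0 (fun j => INR j * (a j * sin (INR j * t)) * -1) N);
        [apply sum_eq; intros; ring | rewrite <- scal_sum; ring]. }
    unfold a at 1; rewrite (pf_vector_sum N n mu b (fun j => sin (INR j * t)) pf_b).
    f_equal; f_equal; f_equal.
    * unfold trig_cos, trig_sin; rewrite !scal_sum, <- minus_sum.
      apply sum_eq; intros j Hj; rewrite HS by trivial.
      rewrite Rmult_minus_distr_r, sin_minus; fold (a j); ring.
    * unfold trig_cos, trig_sin; rewrite !scal_sum, <- plus_sum.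
      apply sum_eq; intros j Hj.
      replace (INR (S j) * t) with (INR j * t + t) by (rewrite S_INR; ring).
      rewrite sin_plus; fold (a j); ring.
- eapply is_derive_value.
  + apply (is_derive_sum_f_R0 (fun j t => a j * sin (INR j * t))
      (fun j t => INR j * (a j * cos (INR j * t)))).
    intros j; auto_derive; [trivial | ring].
  + unfold a at 1; rewrite (pf_vector_sum N n mu b (fun j => cos (INR j * t)) pf_b).
    f_equal; f_equal.
    * unfold trig_cos, trig_sin; rewrite !scal_sum, <- plus_sum.
      apply sum_eq; intros j Hj; rewrite HS by trivial.
      rewrite Rmult_minus_distr_r, cos_minus; fold (a j); ring.
    * unfold trig_cos, trig_sin; rewrite !scal_sum, <- minus_sum.
      apply sum_eq; intros j Hj.
      replace (INR (S j) * t) with (INR j * t + t) by (rewrite S_INR; ring).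
      rewrite cos_plus; fold (a j); ring.
Qed.

Let psi (t : R) : R := phi t - phi 0 - l * t.
(* [G + i F = exp (i psi / 2) E(exp (i t))]; the phase [phi] of [v / u] makes it
   real. *)
Let F (t : R) : R := trig_cos a N t * sin (psi t / 2) + trig_sin a N t * cos (psi t / 2).
Let G (t : R) : R := trig_cos a N t * cos (psi t / 2) - trig_sin a N t * sin (psi t / 2).

Lemma half_psi_derive (t : R) :
  is_derive (fun t => psi t / 2) t (mu * cos t - n * sin (phi t)).
Proof.
unfold psi; auto_derive.
- eexists; apply phi_orbit.
- replace (Derive _ t) with (l + 2 * mu * cos t - 2 * n * sin (phi t))
    by (symmetry; apply is_derive_unique, phi_orbit).
  field.
Qed.

(** The initial phase enters here: [exp (- i phi(0)) = - i (-1)^N], which absorbs the sign in the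
    equation of [E]. *)
Lemma rotation_phase (t : R) :
  (-1) ^ N * sin (l * t + psi t / 2) = - cos (phi t - psi t / 2) /\
  (-1) ^ N * cos (l * t + psi t / 2) = sin (phi t - psi t / 2).
Proof.
replace (l * t + psi t / 2) with (phi t - psi t / 2 - phi 0) by (unfold psi; field).
rewrite phi_0; generalize (phi t - psi t / 2); intros u.
pose proof (sin_PI2) as H1; pose proof (cos_PI2) as H2.
destruct (pow_opp1 N) as [H | H]; rewrite H; split.
- rewrite !Rmult_1_l, sin_minus, H1, H2; ring.
- rewrite !Rmult_1_l, cos_minus, H1, H2; ring.
- replace (u - -1 * (PI / 2)) with (u + PI / 2) by ring.
  rewrite sin_plus, H1, H2; ring.
- replace (u - -1 * (PI / 2)) with (u + PI / 2) by ring.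
  rewrite cos_plus, H1, H2; ring.
Qed.

(** [W = G + i F] satisfies [W' = (mu sin t - i n sin phi) W + n exp(i phi) conj(W)]; in the
    imaginary part the terms in [G] cancel. *)
Lemma im_part_derive (t : R) : is_derive F t ((mu * sin t - n * cos (phi t)) * F t).
Proof.
destruct (trig_sum_derive t) as [HX HY].
pose proof (half_psi_derive t) as HA.
destruct (rotation_phase t) as [Hs Hc].
unfold F.
eapply is_derive_value.
- apply (is_derive_plus (fun t => trig_cos a N t * sin (psi t / 2))
    (fun t => trig_sin a N t * cos (psi t / 2))).
  + apply (is_derive_mul (trig_cos a N) (fun t => sin (psi t / 2))); [exact HX |].
    exact (is_derive_sin_comp _ _ _ HA).
  + apply (is_derive_mul (trig_sin a N) (fun t => cos (psi t / 2))); [exact HY |].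
    exact (is_derive_cos_comp _ _ _ HA).
- unfold plus, mult, scal; simpl; unfold mult; simpl.
  rewrite sin_plus in Hs; rewrite cos_plus in Hc; rewrite cos_minus in Hs; rewrite sin_minus in Hc.
  set (A := psi t / 2) in *; set (X := trig_cos a N t) in *; set (Y := trig_sin a N t) in *.
  set (e := (-1) ^ N) in *.
  nsatz.
Qed.

Lemma im_part_zero (t : R) : F t = 0.
Proof.
apply (linear_ode_zero F (fun t => mu * sin t - n * cos (phi t)) (Rabs mu + n) 0 t).
- apply im_part_derive.
- intros x; unfold Rminus; eapply Rle_trans; [apply Rabs_triang |].
  rewrite Rabs_Ropp, !Rabs_mult, (Rabs_right n) by lra.
  assert (Rabs (sin x) <= 1) by (apply Rabs_le, SIN_bound).
  assert (Rabs (cos (phi x)) <= 1) by (apply Rabs_le, COS_bound).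
  pose proof (Rabs_pos mu); nra.
- unfold F, psi.
  replace ((phi 0 - phi 0 - l * 0) / 2) with 0 by field.
  rewrite sin_0, cos_0.
  replace (trig_sin a N 0) with 0; [ring |].
  symmetry; unfold trig_sin; apply sum_eq_R0; intros; rewrite Rmult_0_r, sin_0; ring.
Qed.

(** The real part of the same equation has the extra term [2 n sin(phi) F], which vanishes by
    [im_part_zero]. *)
Lemma re_part_derive (t : R) : is_derive G t ((mu * sin t + n * cos (phi t)) * G t).
Proof.
destruct (trig_sum_derive t) as [HX HY].
pose proof (half_psi_derive t) as HA.
destruct (rotation_phase t) as [Hs Hc].
pose proof (im_part_zero t) as HF.
unfold G; unfold F in HF.
eapply is_derive_value.
- apply (is_derive_minus (fun t => trig_cos a N t * cos (psi t / 2))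
    (fun t => trig_sin a N t * sin (psi t / 2))).
  + apply (is_derive_mul (trig_cos a N) (fun t => cos (psi t / 2))); [exact HX |].
    exact (is_derive_cos_comp _ _ _ HA).
  + apply (is_derive_mul (trig_sin a N) (fun t => sin (psi t / 2))); [exact HY |].
    exact (is_derive_sin_comp _ _ _ HA).
- unfold minus, opp, plus, mult, scal; simpl; unfold mult; simpl.
  rewrite sin_plus in Hs; rewrite cos_plus in Hc; rewrite cos_minus in Hs; rewrite sin_minus in Hc.
  set (A := psi t / 2) in *; set (X := trig_cos a N t) in *; set (Y := trig_sin a N t) in *.
  set (e := (-1) ^ N) in *.
  nsatz.
Qed.

Lemma trig_cos_re_part (t : R) : trig_cos a N t = G t * cos (psi t / 2).
Proof.
pose proof (im_part_zero t) as HF; unfold F in HF; unfold G.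
pose proof (sin2_cos2 (psi t / 2)) as H; unfold Rsqr in H; nsatz.
Qed.

Lemma trig_sin_re_part (t : R) : trig_sin a N t = - G t * sin (psi t / 2).
Proof.
pose proof (im_part_zero t) as HF; unfold F in HF; unfold G.
pose proof (sin2_cos2 (psi t / 2)) as H; unfold Rsqr in H; nsatz.
Qed.

(** A zero would propagate to [PI], but at [z = -1] the alternating signs cancel and [E(-1)] is a
    sum of positive terms. *)
Lemma re_part_nonzero (t : R) : G t <> 0.
Proof.
intros H.
assert (HPI : G PI = 0).
{ apply (linear_ode_zero G (fun t => mu * sin t + n * cos (phi t)) (Rabs mu + n) t PI); trivial.
  - apply re_part_derive.
  - intros x; eapply Rle_trans; [apply Rabs_triang |].
    rewrite !Rabs_mult, (Rabs_right n) by lra.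
    assert (Rabs (sin x) <= 1) by (apply Rabs_le, SIN_bound).
    assert (Rabs (cos (phi x)) <= 1) by (apply Rabs_le, COS_bound).
    pose proof (Rabs_pos mu); nra. }
pose proof (trig_cos_re_part PI) as HX; rewrite HPI in HX.
assert (0 < trig_cos a N PI); [| lra].
apply sum_f_R0_pos; intros m Hm; unfold a.
assert (Hc : cos (INR m * PI) = (-1) ^ m).
{ clear; induction m as [|m IH]; [rewrite Rmult_0_l; apply cos_0 |].
  replace (INR (S m) * PI) with (INR m * PI + PI) by (rewrite S_INR; ring).
  rewrite neg_cos, IH; simpl; ring. }
rewrite Hc; replace ((-1) ^ m * b m * (-1) ^ m) with (((-1) ^ m * (-1) ^ m) * b m) by ring.
rewrite <- Rpow_mult_distr; replace (-1 * -1) with 1 by ring; rewrite pow1, Rmult_1_l.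
destruct pf_b as [Hb _]; apply Hb; lia.
Qed.

Lemma re_part_0 : G 0 = trig_cos a N 0.
Proof.
rewrite trig_cos_re_part; unfold psi at 1.
replace ((phi 0 - phi 0 - l * 0) / 2) with 0 by field; rewrite cos_0; ring.
Qed.

Lemma trig_cos_2PI : trig_cos a N (2 * PI) = trig_cos a N 0.
Proof.
apply sum_eq; intros j _.
replace (INR j * (2 * PI)) with (INR j * 0 + 2 * INR j * PI) by ring; now rewrite cos_period.
Qed.

Lemma trig_sin_2PI : trig_sin a N (2 * PI) = 0.
Proof.
apply sum_eq_R0; intros j _.
replace (INR j * (2 * PI)) with (0 + 2 * INR j * PI) by ring; rewrite sin_period, sin_0; ring.
Qed.

(** [E(exp(i t))] is periodic and real at 0, so [F (2 * PI) = 0] leaves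
    [sin (psi (2 * PI) / 2) = 0]. *)
Lemma orbit_closes : exists m : Z, phi (2 * PI) = phi 0 + 2 * PI * l + 2 * PI * IZR m.
Proof.
pose proof (im_part_zero (2 * PI)) as HF; unfold F in HF.
rewrite trig_cos_2PI, trig_sin_2PI, Rmult_0_l, Rplus_0_r, <- re_part_0 in HF.
apply Rmult_integral in HF; destruct HF as [HF | HF]; [now apply re_part_nonzero in HF |].
apply sin_eq_0_0 in HF; destruct HF as [m Hm]; exists m.
unfold psi in Hm; lra.
Qed.

Lemma pf_orbit_polar : exists G : R -> R,
  (forall t, is_derive G t ((mu * sin t + n * cos (phi t)) * G t)) /\
  (forall t, G t <> 0) /\
  (forall t, trig_cos (fun j => (-1) ^ j * b j) N t
     = G t * cos ((phi t - phi 0 - INR (S N) * t) / 2)) /\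
  (forall t, trig_sin (fun j => (-1) ^ j * b j) N t
     = - G t * sin ((phi t - phi 0 - INR (S N) * t) / 2)).
Proof.
exists G; split; [| split; [| split]]; [exact re_part_derive | exact re_part_nonzero | exact trig_cos_re_part | exact trig_sin_re_part].
Qed.
End PeriodicOrbit.

(** * Bessel integrals *)

Lemma is_RInt_derive_periodic (f df : R -> R) :
  (forall t, is_derive f t (df t)) -> (forall t, continuous df t) -> f (2 * PI) = f 0 ->
  is_RInt df 0 (2 * PI) 0.
Proof.
intros Hf Hdf Hp.
replace 0 with (minus (f (2 * PI)) (f 0)) at 2 by (rewrite Hp; apply Rminus_diag).
apply (is_RInt_derive f df); intros; trivial.
Qed.

(** The real part of [z^k exp(- mu / z)] at [z = exp(i t)]; its integral is [2 PI (-mu)^k / k!]. *)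
Definition bessel_integrand (k : nat) (mu t : R) : R :=
  exp (- mu * cos t) * cos (INR k * t + mu * sin t).

Lemma bessel_integrand_continuous (k : nat) (mu t : R) : continuous (bessel_integrand k mu) t.
Proof. apply (ex_derive_continuous (bessel_integrand k mu)); unfold bessel_integrand; auto_derive; trivial. Qed.

Lemma bessel_integrand_RInt (k : nat) (mu : R) :
  is_RInt (bessel_integrand k mu) 0 (2 * PI) (RInt (bessel_integrand k mu) 0 (2 * PI)).
Proof.
apply (RInt_correct (bessel_integrand k mu)), (ex_RInt_continuous (bessel_integrand k mu)).
intros; apply bessel_integrand_continuous.
Qed.

(* Cauchy's mean value formula for [exp (- mu / z)]: the derivative in [mu] is
   the integral of an exact derivative. *)
Lemma bessel_0 (mu : R) : 0 <= mu -> RInt (bessel_integrand 0 mu) 0 (2 * PI) = 2 * PI.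
Proof.
intros Hmu; pose proof PI_RGT_0.
set (g := fun s => RInt (fun t => exp (- s * cos t) * cos (s * sin t)) 0 (2 * PI)).
assert (Hg : forall s, g s = RInt (bessel_integrand 0 s) 0 (2 * PI)).
{ intros s; apply RInt_ext; intros t _; unfold bessel_integrand; simpl.
  now rewrite Rmult_0_l, Rplus_0_l. }
rewrite <- Hg.
assert (Hg0 : g 0 = 2 * PI).
{ unfold g; rewrite (RInt_ext _ (fun _ => 1)).
  - rewrite RInt_const; unfold scal; simpl; unfold mult; simpl; ring.
  - intros t _; rewrite Ropp_0, !Rmult_0_l, exp_0, cos_0; apply Rmult_1_l. }
pose (dg := fun s t => - (exp (- s * cos t) * cos (t - s * sin t))).
assert (Hdg : forall s t, is_derive (fun s => exp (- s * cos t) * cos (s * sin t)) s (dg s t)).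
{ intros s t; unfold dg; auto_derive; [trivial | rewrite cos_minus; ring]. }
assert (Hc2 : forall s t, continuity_2d_pt dg s t).
{ intros s t; unfold dg.
  assert (Hcos : continuity_2d_pt (fun _ v => cos v) s t)
    by (apply (continuity_1d_2d_pt_comp cos); [apply continuity_cos | apply continuity_2d_pt_id2]).
  assert (Hsin : continuity_2d_pt (fun _ v => sin v) s t)
    by (apply (continuity_1d_2d_pt_comp sin); [apply continuity_sin | apply continuity_2d_pt_id2]).
  apply continuity_2d_pt_opp, continuity_2d_pt_mult.
  - apply (continuity_1d_2d_pt_comp exp (fun u v => - u * cos v)).
    + apply derivable_continuous_pt, derivable_pt_exp.
    + apply continuity_2d_pt_mult; [apply continuity_2d_pt_opp, continuity_2d_pt_id1 | trivial].
  - apply (continuity_1d_2d_pt_comp cos (fun u v => v - u * sin v)); [apply continuity_cos |].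
    apply continuity_2d_pt_minus; [apply continuity_2d_pt_id2 |].
    apply continuity_2d_pt_mult; [apply continuity_2d_pt_id1 | trivial]. }
assert (Hd : forall s, is_derive g s (RInt (dg s) 0 (2 * PI))).
{ intros s; eapply is_derive_value.
  - apply (is_derive_RInt_param (fun s t => exp (- s * cos t) * cos (s * sin t)) 0 (2 * PI) s).
    + apply filter_forall; intros y t _; eexists; apply Hdg.
    + intros t _; apply (continuity_2d_pt_ext dg); [| apply Hc2].
      intros; symmetry; apply is_derive_unique, Hdg.
    + apply filter_forall; intros y; apply (ex_RInt_continuous (fun t => exp (- y * cos t) * cos (y * sin t))).
      intros t _; apply (ex_derive_continuous (fun t => exp (- y * cos t) * cos (y * sin t))).
      auto_derive; trivial.
  - apply RInt_ext; intros t _; apply is_derive_unique, Hdg. }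
assert (Hz : forall s, RInt (dg s) 0 (2 * PI) = 0).
{ intros s; apply is_RInt_unique.
  assert (Hdc : forall t, continuous (dg s) t).
  { intros t; apply (ex_derive_continuous (dg s)); unfold dg; auto_derive; trivial. }
  (* The primitive of the general case divides by [s]. *)
  destruct (Req_dec s 0) as [-> | Hs].
  - apply (is_RInt_derive_periodic (fun t => - sin t)); trivial.
    + intros t; unfold dg; auto_derive; trivial.
      rewrite Ropp_0, !Rmult_0_l, exp_0, Rminus_0_r; ring.
    + rewrite sin_2PI, sin_0; ring.
  - apply (is_RInt_derive_periodic (fun t => - (exp (- s * cos t) * sin (s * sin t)) / s)); trivial.
    + intros t; unfold dg; auto_derive; trivial.
      rewrite cos_minus; field; trivial.
    + rewrite sin_2PI, sin_0, cos_2PI, cos_0; reflexivity. }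
destruct (MVT_gen g 0 mu (fun s => RInt (dg s) 0 (2 * PI))) as [c [_ Hc]].
- intros; apply Hd.
- intros; apply continuity_pt_filterlim; eapply is_derive_continuous, Hd.
- rewrite Hz, Rmult_0_l in Hc; lra.
Qed.

(** Integrating an exact derivative gives [(k + 1) I_(k+1) + mu I_k = 0], and [I_0 = 2 PI]. *)
Lemma bessel_nonzero (k : nat) (mu : R) : 0 < mu ->
  RInt (bessel_integrand k mu) 0 (2 * PI) <> 0.
Proof.
intros Hmu; pose proof PI_RGT_0; induction k as [|k IH].
- rewrite bessel_0; lra.
- intros H0; apply IH.
  assert (Hp : is_RInt (fun t => INR (S k) * bessel_integrand (S k) mu t + mu * bessel_integrand k mu t)
    0 (2 * PI) 0).
  { apply (is_RInt_derive_periodic (fun t => exp (- mu * cos t) * sin (INR (S k) * t + mu * sin t))).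
    - intros t; unfold bessel_integrand; auto_derive; trivial.
      replace (INR k * t + mu * sin t) with (INR (S k) * t + mu * sin t - t) by (rewrite S_INR; ring).
      rewrite cos_minus; simpl INR; ring.
    - intros t; apply (continuous_plus (fun t => INR (S k) * bessel_integrand (S k) mu t)
        (fun t => mu * bessel_integrand k mu t));
      [apply (continuous_scal_r (INR (S k)) (bessel_integrand (S k) mu))
      | apply (continuous_scal_r mu (bessel_integrand k mu))]; apply bessel_integrand_continuous.
    - rewrite sin_2PI, sin_0, cos_2PI, cos_0.
      replace (INR (S k) * (2 * PI) + mu * 0) with (INR (S k) * 0 + mu * 0 + 2 * INR (S k) * PI) by ring.
      now rewrite sin_period. }
  pose proof (is_RInt_plus _ _ _ _ _ _ (is_RInt_scal _ _ _ (INR (S k)) _ (bessel_integrand_RInt (S k) mu))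
    (is_RInt_scal _ _ _ mu _ (bessel_integrand_RInt k mu))) as Hq.
  rewrite H0 in Hq.
  assert (Eq : INR (S k) * 0 + mu * RInt (bessel_integrand k mu) 0 (2 * PI) = 0).
  { exact (eq_trans (eq_sym (is_RInt_unique _ _ _ _ Hq)) (is_RInt_unique _ _ _ _ Hp)). }
  rewrite Rmult_0_r, Rplus_0_l in Eq.
  apply Rmult_integral in Eq; destruct Eq; lra.
Qed.

(** * The Poincare map is not the identity *)

(** From [k^2 + n^2 >= 2 k n] the coefficient at [k = m + 1] is at least [2 mu k], so [|V|] is
    convex. Starting from 0 it grows at least like [m |V_1|], and boundedness forces [V_1 = 0]. *)
Lemma bounded_recursion_zero (V : nat -> R) (M mu l n : R) :
  0 < mu -> 2 * mu <= 2 * n + l -> V 0%nat = 0 -> (forall m, Rabs (V m) <= M) ->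
  (forall m, mu * INR (S m) * (V (S (S m)) + V m)
     = - (INR (S m) * INR (S m) + l * INR (S m) + n * n) * V (S m)) ->
  forall m, V m = 0.
Proof.
intros Hmu Hl H0 HM Hrec.
assert (Hstep : forall m, 2 * Rabs (V (S m)) <= Rabs (V (S (S m))) + Rabs (V m)).
{ intros m; specialize (Hrec m).
  assert (Hk : 0 < INR (S m)) by (apply lt_0_INR; lia).
  set (k := INR (S m)) in *.
  assert (Hc : 2 * (mu * k) <= k * k + l * k + n * n) by (pose proof (pow2_ge_0 (k - n)); nra).
  assert (Hmk : 0 < mu * k) by (apply Rmult_lt_0_compat; lra).
  apply (f_equal Rabs) in Hrec; rewrite !Rabs_mult, Rabs_Ropp in Hrec.
  rewrite <- (Rabs_mult mu k), (Rabs_right (mu * k)), (Rabs_right (_ + _ + _)) in Hrec by lra.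
  apply Rmult_le_reg_l with (mu * k); trivial.
  apply Rle_trans with (mu * k * Rabs (V (S (S m)) + V m)).
  - rewrite Hrec; pose proof (Rabs_pos (V (S m))); nra.
  - apply Rmult_le_compat_l; [lra | apply Rabs_triang]. }
assert (Hgrow : forall m, Rabs (V m) + Rabs (V 1%nat) <= Rabs (V (S m))).
{ induction m as [|m IH].
  - rewrite H0, Rabs_R0; lra.
  - specialize (Hstep m); lra. }
assert (Hlin : forall m, INR m * Rabs (V 1%nat) <= Rabs (V m)).
{ induction m as [|m IH].
  - simpl; rewrite Rmult_0_l; apply Rabs_pos.
  - rewrite S_INR; specialize (Hgrow m); lra. }
assert (H1 : V 1%nat = 0).
{ destruct (Req_dec (V 1%nat) 0) as [H | H]; trivial; exfalso.
  apply Rabs_pos_lt in H.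
  destruct (INR_unbounded (M / Rabs (V 1%nat))) as [m Hm].
  apply Rlt_div_l in Hm; [| trivial].
  specialize (HM m); specialize (Hlin m); lra. }
cut (forall m, V m = 0 /\ V (S m) = 0); [intros H m; apply H |].
induction m as [|m [IH1 IH2]]; split; trivial.
specialize (Hrec m); rewrite IH1, IH2, Rplus_0_r, Rmult_0_r in Hrec.
apply Rmult_integral in Hrec; destruct Hrec as [H | H]; trivial; exfalso.
assert (0 < mu * INR (S m)) by (apply Rmult_lt_0_compat; [trivial | apply lt_0_INR; lia]); lra.
Qed.

Lemma is_RInt_lin (f g : R -> R) (x y A B u v : R) :
  is_RInt f u v A -> is_RInt g u v B -> is_RInt (fun t => x * f t + y * g t) u v (x * A + y * B).
Proof. intros Hf Hg; exact (is_RInt_plus _ _ _ _ _ _ (is_RInt_scal _ _ _ x _ Hf) (is_RInt_scal _ _ _ y _ Hg)). Qed.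

Lemma is_RInt_eq (f : R -> R) (u v A B : R) : is_RInt f u v A -> is_RInt f u v B -> A = B.
Proof. intros HA HB; exact (eq_trans (eq_sym (is_RInt_unique _ _ _ _ HA)) (is_RInt_unique _ _ _ _ HB)). Qed.

Lemma is_RInt_sum_zero (f : nat -> R -> R) (c : nat -> R) (N : nat) (u v : R) :
  (forall j, (j <= N)%nat -> is_RInt (f j) u v 0) ->
  is_RInt (fun t => sum_f_R0 (fun j => c j * f j t) N) u v 0.
Proof.
intros H; induction N as [|N IH].
- replace 0 with (c 0%nat * 0) by ring.
  apply (is_RInt_scal (f 0%nat) u v (c 0%nat) 0), H; lia.
- replace 0 with (1 * 0 + c (S N) * 0) by ring.
  apply (is_RInt_ext (fun t => 1 * sum_f_R0 (fun j => c j * f j t) N + c (S N) * f (S N) t)).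
  + intros t _; rewrite Rmult_1_l; reflexivity.
  + apply is_RInt_lin; [apply IH; intros; apply H; lia | apply H; lia].
Qed.

Lemma linear_phase_derive (f : R -> R) (x t df : R) : is_derive f t df ->
  is_derive (fun t => f t + x * t) t (df + x).
Proof.
intros Hf; eapply is_derive_value.
- apply (is_derive_plus f (fun t => x * t)); [exact Hf |].
  auto_derive; [trivial | reflexivity].
- unfold plus; simpl; ring.
Qed.

Lemma continuous_lin (f g : R -> R) (x y t : R) :
  continuous f t -> continuous g t -> continuous (fun t => x * f t + y * g t) t.
Proof.
intros Hf Hg; apply (continuous_plus (fun t => x * f t) (fun t => y * g t)).
- now apply (continuous_scal_r x f).
- now apply (continuous_scal_r y g).
Qed.

Lemma sin_add_2PI (x y : R) (m : nat) : x = y + 2 * INR m * PI -> sin x = sin y.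
Proof. intros ->; apply sin_period. Qed.

Lemma cos_add_2PI (x y : R) (m : nat) : x = y + 2 * INR m * PI -> cos x = cos y.
Proof. intros ->; apply cos_period. Qed.

Section NotIdentity.
Variables (N : nat) (n mu : R) (phi : R -> R).
Hypothesis n_pos : 0 < n.
Hypothesis phi_orbit : is_orbit (INR (S N)) mu (2 * n) phi.
Hypothesis phi_period : phi (2 * PI) = phi 0 + 2 * PI * INR (S N).

Let l : R := INR (S N).

(* [u = orbit_modulus * exp (i orbit_phase)] and [v = exp (i phi) u] solve the
   linear system. *)
Definition orbit_phase (t : R) : R := mu * sin t - (phi t - phi 0 - l * t) / 2.
Definition orbit_modulus (t : R) : R := exp (n * RInt (fun s => cos (phi s)) 0 t).

Lemma orbit_phase_derive (t : R) : is_derive orbit_phase t (n * sin (phi t)).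
Proof.
unfold orbit_phase; auto_derive.
- eexists; apply phi_orbit.
- replace (Derive _ t) with (l + 2 * mu * cos t - 2 * n * sin (phi t))
    by (symmetry; apply is_derive_unique, phi_orbit).
  field.
Qed.

Lemma orbit_phase_0 : orbit_phase 0 = 0.
Proof. unfold orbit_phase; rewrite sin_0; field. Qed.

Lemma orbit_phase_2PI : orbit_phase (2 * PI) = 0.
Proof. unfold orbit_phase; rewrite sin_2PI, phi_period; fold l; field. Qed.

Lemma orbit_modulus_derive (t : R) :
  is_derive orbit_modulus t (n * cos (phi t) * orbit_modulus t).
Proof.
assert (Hc : forall s, continuous (fun s => cos (phi s)) s).
{ intros s; apply (continuous_comp phi cos); [eapply orbit_continuous, phi_orbit |].
  apply (ex_derive_continuous cos); auto_derive; trivial. }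
assert (Hd : is_derive (fun t => RInt (fun s => cos (phi s)) 0 t) t (cos (phi t))).
{ apply (is_derive_RInt (fun s => cos (phi s)) _ 0); [| apply Hc].
  apply filter_forall; intros y; apply (RInt_correct (fun s => cos (phi s))).
  apply (ex_RInt_continuous (fun s => cos (phi s))); intros; apply Hc. }
unfold orbit_modulus; eapply is_derive_value.
- apply (is_derive_comp exp (fun t => n * RInt (fun s => cos (phi s)) 0 t)).
  + apply is_derive_exp.
  + apply (is_derive_scal (fun t => RInt (fun s => cos (phi s)) 0 t)), Hd.
- unfold scal; simpl; unfold mult; simpl; ring.
Qed.

Lemma orbit_modulus_0 : orbit_modulus 0 = 1.
Proof. unfold orbit_modulus; rewrite RInt_point; unfold zero; simpl; rewrite Rmult_0_r; apply exp_0. Qed.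

Let beta (t : R) : R := orbit_phase t + phi t.

Lemma beta_derive (t : R) : is_derive beta t (l + 2 * mu * cos t - n * sin (phi t)).
Proof.
unfold beta; eapply is_derive_value.
- apply (is_derive_plus orbit_phase phi); [apply orbit_phase_derive | apply phi_orbit].
- change (n * sin (phi t) + (l + 2 * mu * cos t - 2 * n * sin (phi t))
    = l + 2 * mu * cos t - n * sin (phi t)).
  ring.
Qed.

(** The imaginary part of [v z^m] and the real part of [u z^m], where [u' = n v] and
    [v' = i (l + 2 mu cos t) v + n u]. *)
Definition fourier_v (m : nat) (t : R) : R := orbit_modulus t * sin (orbit_phase t + phi t + INR m * t).
Definition fourier_u (m : nat) (t : R) : R := orbit_modulus t * cos (orbit_phase t + INR m * t).

Lemma fourier_v_continuous (m : nat) (t : R) : continuous (fourier_v m) t.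
Proof.
eapply is_derive_continuous.
apply (is_derive_mul orbit_modulus (fun t => sin (beta t + INR m * t))).
- apply orbit_modulus_derive.
- apply (is_derive_sin_comp (fun t => beta t + INR m * t)), linear_phase_derive, beta_derive.
Qed.

Lemma fourier_u_continuous (m : nat) (t : R) : continuous (fourier_u m) t.
Proof.
eapply is_derive_continuous.
apply (is_derive_mul orbit_modulus (fun t => cos (orbit_phase t + INR m * t))).
- apply orbit_modulus_derive.
- apply (is_derive_cos_comp (fun t => orbit_phase t + INR m * t)), linear_phase_derive, orbit_phase_derive.
Qed.

Let V (m : nat) : R := RInt (fourier_v m) 0 (2 * PI).
Let U (m : nat) : R := RInt (fourier_u m) 0 (2 * PI).

Lemma V_correct (m : nat) : is_RInt (fourier_v m) 0 (2 * PI) (V m).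
Proof.
apply (RInt_correct (fourier_v m)), (ex_RInt_continuous (fourier_v m)).
intros; apply fourier_v_continuous.
Qed.

Lemma U_correct (m : nat) : is_RInt (fourier_u m) 0 (2 * PI) (U m).
Proof.
apply (RInt_correct (fourier_u m)), (ex_RInt_continuous (fourier_u m)).
intros; apply fourier_u_continuous.
Qed.

(** With the closed phase this makes [u] and [v] periodic; [pf_orbit_not_identity] derives it from
    the Wronskian. *)
Hypothesis modulus_period : orbit_modulus (2 * PI) = 1.

(** The imaginary part of the integral of [(u z^m)' = (n v + i m u) z^m] over a period. *)
Lemma V_U (m : nat) : n * V m + INR m * U m = 0.
Proof.
eapply is_RInt_eq.
- apply is_RInt_lin; [apply V_correct | apply U_correct].
- apply (is_RInt_derive_periodic (fun t => orbit_modulus t * sin (orbit_phase t + INR m * t))).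
  + intros t; eapply is_derive_value.
    * apply (is_derive_mul orbit_modulus (fun t => sin (orbit_phase t + INR m * t)));
        [apply orbit_modulus_derive |].
      apply (is_derive_sin_comp (fun t => orbit_phase t + INR m * t)), linear_phase_derive, orbit_phase_derive.
    * unfold fourier_v, fourier_u.
      replace (orbit_phase t + phi t + INR m * t) with (orbit_phase t + INR m * t + phi t) by ring.
      generalize (orbit_phase t + INR m * t); intros theta.
      rewrite sin_plus; ring.
  + intros t; apply continuous_lin; [apply fourier_v_continuous | apply fourier_u_continuous].
  + rewrite orbit_phase_2PI, orbit_phase_0, modulus_period, orbit_modulus_0; f_equal.
    apply (sin_add_2PI _ _ m); ring.
Qed.

(** The real part of the integral of [(v z^(m+1))']; the factor [2 cos t = z + 1/z] shifts the index
    both ways. *)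
Lemma U_V (m : nat) :
  n * U (S m) = (l + INR (S m)) * V (S m) + mu * (V (S (S m)) + V m).
Proof.
assert (H : is_RInt (fun t => 1 * (n * fourier_u (S m) t + - (l + INR (S m)) * fourier_v (S m) t)
  + - mu * (1 * fourier_v (S (S m)) t + 1 * fourier_v m t)) 0 (2 * PI) 0).
{ apply (is_RInt_derive_periodic (fun t => orbit_modulus t * cos (beta t + INR (S m) * t))).
  + intros t; eapply is_derive_value.
    * apply (is_derive_mul orbit_modulus (fun t => cos (beta t + INR (S m) * t)));
        [apply orbit_modulus_derive |].
      apply (is_derive_cos_comp (fun t => beta t + INR (S m) * t)), linear_phase_derive, beta_derive.
    * unfold fourier_v, fourier_u; fold (beta t).
      replace (beta t + INR (S (S m)) * t) with (beta t + INR (S m) * t + t) by (rewrite (S_INR (S m)); ring).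
      replace (beta t + INR m * t) with (beta t + INR (S m) * t - t) by (rewrite (S_INR m); ring).
      replace (orbit_phase t + INR (S m) * t) with (beta t + INR (S m) * t - phi t) by (unfold beta; ring).
      generalize (beta t + INR (S m) * t); intros theta.
      rewrite sin_plus, sin_minus, cos_minus; ring.
  + intros t; repeat apply continuous_lin; apply fourier_v_continuous || apply fourier_u_continuous.
  + unfold beta; rewrite orbit_phase_2PI, orbit_phase_0, modulus_period, orbit_modulus_0; f_equal.
    rewrite phi_period.
    apply (cos_add_2PI _ _ (S N + S m)); rewrite plus_INR; ring. }
assert (E := is_RInt_eq _ _ _ _ _ H
  (is_RInt_lin _ _ 1 (- mu) _ _ _ _
    (is_RInt_lin _ _ n (- (l + INR (S m))) _ _ _ _ (U_correct (S m)) (V_correct (S m)))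
    (is_RInt_lin _ _ 1 1 _ _ _ _ (V_correct (S (S m))) (V_correct m)))).
lra.
Qed.

Lemma V_bounded (m : nat) : Rabs (V m) <= RInt orbit_modulus 0 (2 * PI).
Proof.
pose proof PI_RGT_0.
apply (norm_RInt_le (fourier_v m) orbit_modulus 0 (2 * PI)); [lra | | apply V_correct |].
- intros t _; unfold fourier_v; change norm with Rabs.
  assert (Hp : 0 < orbit_modulus t) by apply exp_pos.
  rewrite Rabs_mult, (Rabs_right (orbit_modulus t)) by lra.
  assert (Rabs (sin (orbit_phase t + phi t + INR m * t)) <= 1) by (apply Rabs_le, SIN_bound).
  nra.
- apply (RInt_correct orbit_modulus), (ex_RInt_continuous orbit_modulus).
  intros; eapply is_derive_continuous, orbit_modulus_derive.
Qed.

Hypothesis mu_pos : 0 < mu.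
Hypothesis mu_bound : 2 * mu <= 2 * n + l.

Lemma V_zero (m : nat) : V m = 0.
Proof.
revert m; apply (bounded_recursion_zero V (RInt orbit_modulus 0 (2 * PI)) mu l n); trivial.
- pose proof (V_U 0) as H; simpl in H; rewrite Rmult_0_l, Rplus_0_r in H.
  apply Rmult_integral in H; destruct H; lra.
- apply V_bounded.
- intros m; pose proof (V_U (S m)) as H1; pose proof (U_V m) as H2; nsatz.
Qed.

Lemma U_zero (m : nat) : U (S m) = 0.
Proof.
pose proof (V_U (S m)) as H; rewrite V_zero, Rmult_0_r, Rplus_0_l in H.
apply Rmult_integral in H; destruct H as [H | H]; trivial.
now apply not_0_INR in H.
Qed.

Lemma fourier_v_integral (m : nat) : is_RInt (fourier_v m) 0 (2 * PI) 0.
Proof. pose proof (V_correct m) as H; now rewrite V_zero in H. Qed.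

Lemma fourier_u_integral (m : nat) : is_RInt (fourier_u (S m)) 0 (2 * PI) 0.
Proof. pose proof (U_correct (S m)) as H; now rewrite U_zero in H. Qed.
End NotIdentity.

(* [2 T] is, up to sign, the modulus of the Wronskian divided by
   [exp (mu z)]; its phase is [l t + mu sin t] up to a constant. *)
Lemma pf_orbit_not_identity (N : nat) (n mu : R) (b : nat -> R) (phi psi : R -> R) :
  0 < n -> 0 < mu -> 2 * mu <= 2 * n + INR (S N) -> pf_vector (S N) n mu b ->
  is_orbit (INR (S N)) mu (2 * n) phi -> phi 0 = (-1) ^ N * (PI / 2) ->
  phi (2 * PI) = phi 0 + 2 * PI * INR (S N) ->
  is_orbit (INR (S N)) mu (2 * n) psi -> psi 0 = - phi 0 ->
  psi (2 * PI) <> psi 0 + 2 * PI * INR (S N).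
Proof.
intros Hn Hmu Hbound Hb Hphi Hphi0 Hphi1 Hpsi Hpsi0 Hpsi1.
destruct (pf_orbit_polar N n mu b phi Hn Hb Hphi Hphi0) as [G [HG [HG0 [HX HY]]]].
set (l := INR (S N)) in *.
set (a := fun j => (-1) ^ j * b j) in *.
pose (rho := orbit_modulus n psi).
pose (h := fun t => / 2 * (psi t - phi t)).
assert (Hh : forall t, is_derive h t (- n * (sin (psi t) - sin (phi t)))).
{ intros t; unfold h; eapply is_derive_value.
  - apply (is_derive_scal (fun t => psi t - phi t) t (/ 2)).
    apply (is_derive_minus psi phi); [apply Hpsi | apply Hphi].
  - change (/ 2 * (l + 2 * mu * cos t - 2 * n * sin (psi t) - (l + 2 * mu * cos t - 2 * n * sin (phi t)))
      = - n * (sin (psi t) - sin (phi t))).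
    field. }
assert (Hrho : forall t, is_derive rho t (n * cos (psi t) * rho t))
  by (intros t; exact (orbit_modulus_derive N n mu psi Hpsi t)).
pose (T := fun t => G t * rho t * sin (h t)).
assert (HT : forall t, is_derive T t (mu * sin t * T t)).
{ intros t; eapply is_derive_value.
  - apply (is_derive_mul (fun t => G t * rho t) (fun t => sin (h t))).
    + apply (is_derive_mul G rho); [apply HG | apply Hrho].
    + apply is_derive_sin_comp, Hh.
  - unfold T.
    (* By this identity the contribution of [h'] cancels the terms [n cos phi] and [n cos psi]
       coming from [G] and [rho]. *)
    assert (Hs : (sin (psi t) - sin (phi t)) * cos (h t) = (cos (psi t) + cos (phi t)) * sin (h t)).
    { replace (psi t) with ((psi t + phi t) / 2 + h t) at 1 2 by (unfold h; field).
      replace (phi t) with ((psi t + phi t) / 2 - h t) at 2 4 by (unfold h; field).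
      rewrite sin_plus, sin_minus, cos_plus, cos_minus; ring. }
    nsatz. }
assert (Hc : forall t, T t * exp (mu * cos t) = T 0 * exp (mu * cos 0)).
{ intros t; apply Rminus_diag_uniq.
  apply (linear_ode_zero (fun t => T t * exp (mu * cos t) - T 0 * exp (mu * cos 0)) (fun _ => 0) 0 0 t).
  - intros x; eapply is_derive_value.
    + apply (is_derive_minus (fun t => T t * exp (mu * cos t)) (fun _ => T 0 * exp (mu * cos 0))).
      * apply (is_derive_mul T (fun t => exp (mu * cos t))); [apply HT |].
        auto_derive; [trivial | reflexivity].
      * apply is_derive_const.
    + unfold minus, plus, opp, zero; simpl; ring.
  - intros x; rewrite Rabs_R0; lra.
  - apply Rminus_diag. }
assert (Hrho0 : rho 0 = 1) by apply orbit_modulus_0.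
assert (HA0 : forall t, phi t = phi 0 + l * t -> trig_cos a N t = G t).
{ intros t Ht; rewrite HX, Ht; replace ((phi 0 + l * t - phi 0 - l * t) / 2) with 0 by field.
  rewrite cos_0; ring. }
assert (HG1 : G (2 * PI) = G 0).
{ rewrite <- !HA0; [apply trig_cos_2PI | ring | rewrite Hphi1; ring]. }
assert (Hsh : sin (h 0) <> 0).
{ unfold h; rewrite Hpsi0; replace (/ 2 * (- phi 0 - phi 0)) with (- phi 0) by field.
  rewrite sin_neg, Hphi0; pose proof sin_PI2.
  destruct (pow_opp1 N) as [E | E]; rewrite E.
  - rewrite Rmult_1_l; lra.
  - replace (-1 * (PI / 2)) with (- (PI / 2)) by ring; rewrite sin_neg; lra. }
(* [G] and [h] return to their initial values, so conservation of [T * exp (mu * cos t)] forces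
   [rho] to return too. *)
assert (Hrho1 : rho (2 * PI) = 1).
{ specialize (Hc (2 * PI)); unfold T in Hc.
  replace (h (2 * PI)) with (h 0) in Hc by (unfold h; rewrite Hphi1, Hpsi1; field).
  rewrite HG1, Hrho0, cos_2PI, cos_0 in Hc.
  apply Rmult_eq_reg_l with (G 0 * sin (h 0) * exp (mu * 1)).
  - lra.
  - pose proof (exp_pos (mu * 1)); specialize (HG0 0).
    repeat apply Rmult_integral_contrapositive_currified; trivial; lra. }
assert (HV := fourier_v_integral N n mu psi Hn Hpsi Hpsi1 Hrho1 Hmu Hbound).
assert (HU := fourier_u_integral N n mu psi Hn Hpsi Hpsi1 Hrho1 Hmu Hbound).
(* The indices [S (N - j)] are at least 1, the range in which the coefficients of [u] are known to
   vanish. *)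
assert (Hsum : is_RInt (fun t => 1 * sum_f_R0 (fun j => a j * fourier_v N n mu psi j t) N
  + - (-1) ^ N * sum_f_R0 (fun j => a j * fourier_u N n mu psi (S (N - j)) t) N) 0 (2 * PI)
  (1 * 0 + - (-1) ^ N * 0)).
{ apply is_RInt_lin; apply is_RInt_sum_zero; intros; [apply HV | apply HU]. }
(* Pointwise the combination is a nonzero constant times the Bessel integrand of order [N + 1],
   whose integral is not 0. *)
assert (Hpt : forall t, 1 * sum_f_R0 (fun j => a j * fourier_v N n mu psi j t) N
  + - (-1) ^ N * sum_f_R0 (fun j => a j * fourier_u N n mu psi (S (N - j)) t) N
  = 2 * (T 0 * exp (mu * cos 0)) * bessel_integrand (S N) mu t).
{ intros t.
  set (alpha := orbit_phase N mu psi t).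
  set (A := (phi t - phi 0 - l * t) / 2) in *.
  assert (E1 : sum_f_R0 (fun j => a j * fourier_v N n mu psi j t) N
    = rho t * G t * sin (alpha + psi t - A)).
  { transitivity (rho t * (sin (alpha + psi t) * trig_cos a N t + cos (alpha + psi t) * trig_sin a N t)).
    - unfold trig_cos, trig_sin; rewrite !scal_sum, <- plus_sum, scal_sum.
      apply sum_eq; intros j _; unfold fourier_v; fold rho; fold alpha.
      rewrite (sin_plus (alpha + psi t)); ring.
    - rewrite HX, HY; fold A; rewrite (sin_minus (alpha + psi t)); ring. }
  assert (E2 : sum_f_R0 (fun j => a j * fourier_u N n mu psi (S (N - j)) t) N
    = rho t * G t * cos (alpha + l * t + A)).
  { transitivity (rho t * (cos (alpha + l * t) * trig_cos a N t + sin (alpha + l * t) * trig_sin a N t)).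
    - unfold trig_cos, trig_sin; rewrite !scal_sum, <- plus_sum, scal_sum.
      apply sum_eq; intros j Hj; unfold fourier_u; fold rho; fold alpha.
      replace (alpha + INR (S (N - j)) * t) with (alpha + l * t - INR j * t).
      + rewrite (cos_minus (alpha + l * t)); ring.
      + unfold l; rewrite !S_INR, minus_INR by trivial; ring.
    - rewrite HX, HY; fold A; rewrite (cos_plus (alpha + l * t)); ring. }
  rewrite E1, E2.
  assert (E3 : (-1) ^ N * cos (alpha + l * t + A) = sin (alpha + phi t - A)).
  { replace (alpha + l * t + A) with (alpha + phi t - A - phi 0) by (unfold A; field).
    rewrite Hphi0; generalize (alpha + phi t - A); intros u.
    pose proof sin_PI2 as H1; pose proof cos_PI2 as H2.
    destruct (pow_opp1 N) as [E | E]; rewrite E.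
    - rewrite !Rmult_1_l, cos_minus, H1, H2; ring.
    - replace (u - -1 * (PI / 2)) with (u + PI / 2) by ring.
      rewrite cos_plus, H1, H2; ring. }
  (* The choice [psi 0 = - phi 0] removes the constant phase. *)
  assert (E4 : alpha - A + (phi t + psi t) / 2 = l * t + mu * sin t).
  { unfold alpha, A, orbit_phase; fold l; rewrite Hpsi0; field. }
  assert (E5 : T t = T 0 * exp (mu * cos 0) * exp (- mu * cos t)).
  { rewrite <- (Hc t), Rmult_assoc, <- exp_plus.
    replace (mu * cos t + - mu * cos t) with 0 by ring; rewrite exp_0; ring. }
  transitivity (2 * T t * cos (l * t + mu * sin t)).
  - replace (- (-1) ^ N * (rho t * G t * cos (alpha + l * t + A))) with
      (- (rho t * G t) * ((-1) ^ N * cos (alpha + l * t + A))) by ring.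
    rewrite E3, <- E4; unfold T.
    set (w := alpha - A + (phi t + psi t) / 2).
    replace (alpha + psi t - A) with (w + h t) by (unfold w, h; field).
    replace (alpha + phi t - A) with (w - h t) by (unfold w, h; field).
    rewrite sin_plus, sin_minus; ring.
  - rewrite E5; unfold bessel_integrand; fold l; ring. }
assert (Hfin : is_RInt (fun t => 2 * (T 0 * exp (mu * cos 0)) * bessel_integrand (S N) mu t) 0 (2 * PI)
  (1 * 0 + - (-1) ^ N * 0)).
{ apply (is_RInt_ext (fun t => 1 * sum_f_R0 (fun j => a j * fourier_v N n mu psi j t) N
    + - (-1) ^ N * sum_f_R0 (fun j => a j * fourier_u N n mu psi (S (N - j)) t) N)); trivial. }
pose proof (is_RInt_scal _ _ _ (2 * (T 0 * exp (mu * cos 0))) _ (bessel_integrand_RInt (S N) mu)) as Hbes.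
pose proof (is_RInt_eq _ _ _ _ _ Hfin Hbes) as E.
change (1 * 0 + - (-1) ^ N * 0 = 2 * (T 0 * exp (mu * cos 0)) * RInt (bessel_integrand (S N) mu) 0 (2 * PI)) in E.
pose proof (bessel_nonzero (S N) mu Hmu) as Hnz.
assert (Hne : 2 * (T 0 * exp (mu * cos 0)) * RInt (bessel_integrand (S N) mu) 0 (2 * PI) <> 0).
{ pose proof (exp_pos (mu * cos 0)); specialize (HG0 0); unfold T; rewrite Hrho0.
  repeat apply Rmult_integral_contrapositive_currified; trivial; lra. }
apply Hne; rewrite <- E; ring.
Qed.

(** * Phase-lock areas *)

(** The forcing integrates to 0 over a period, so the bound is uniform in [mu], which varies with
    [n] in [pf_orbit_rotation]. *)
Lemma orbit_deviation (a mu k : R) (phi : R -> R) : 0 <= k -> is_orbit a mu k phi ->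
  Rabs (phi (2 * PI) - phi 0 - 2 * PI * a) <= 2 * PI * k.
Proof.
intros Hk H; pose proof PI_RGT_0.
assert (Hd : forall t, is_derive (fun t => phi t - (a * t + 2 * mu * sin t)) t (- k * sin (phi t))).
{ intros t; eapply is_derive_value.
  - apply (is_derive_minus phi (fun t => a * t + 2 * mu * sin t)); [apply H |].
    auto_derive; [trivial | reflexivity].
  - unfold minus, plus, opp; simpl; ring. }
destruct (MVT_gen (fun t => phi t - (a * t + 2 * mu * sin t)) 0 (2 * PI)
  (fun t => - k * sin (phi t))) as [c [_ Hc]].
- intros; apply Hd.
- intros x _; apply continuity_pt_filterlim; exact (is_derive_continuous _ _ _ (Hd x)).
- rewrite sin_2PI, sin_0 in Hc.
  replace (phi (2 * PI) - phi 0 - 2 * PI * a) with (- k * sin (phi c) * (2 * PI)) by lra.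
  assert (- k <= k * sin (phi c) <= k) by (pose proof (SIN_bound (phi c)); split; nra).
  apply Rabs_le; split; nra.
Qed.

Lemma continuity_pt_bound (g B : R -> R) (s : R) :
  (forall x, Rabs (g x - g s) <= B x) -> B s = 0 -> continuous B s -> continuity_pt g s.
Proof.
intros HB H0 Hc; apply continuity_pt_filterlim in Hc; intros eps Heps.
destruct (Hc eps Heps) as [d [Hd H]]; exists d; split; trivial.
intros x Hx; specialize (H x Hx); simpl in *; unfold Rdist in *.
rewrite H0, Rminus_0_r in H.
eapply Rle_lt_trans; [apply HB | eapply Rle_lt_trans; [apply Rle_abs | exact H]].
Qed.

Lemma flow_continuous (a p t : R) (mu k : R -> R) (s : R) :
  0 <= t -> continuous mu s -> continuous k s ->
  continuity_pt (fun x => flow a (mu x) (k x) p t) s.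
Proof.
intros Ht Hmu Hk.
apply (continuity_pt_bound _ (fun x =>
  (2 * Rabs (mu s - mu x) + Rabs (k s - k x)) * exp ((Rabs (k s) + 1) * (t - 0)))).
- intros x; rewrite Rabs_minus_sym.
  apply (orbit_dependence a (mu s) (k s) (mu x) (k x)); try apply flow_orbit; trivial.
  now rewrite !flow_0.
- rewrite !Rminus_diag, Rabs_R0; ring.
- assert (Habs : forall f : R -> R, continuous f s -> continuous (fun x => Rabs (f s - f x)) s).
  { intros f Hf; apply (continuous_comp (fun x => f s - f x) Rabs).
    - apply (continuous_minus (fun _ => f s) f); [apply continuous_const | trivial].
    - apply (continuous_Rabs (f s - f s)). }
  apply (continuous_mult (fun x => 2 * Rabs (mu s - mu x) + Rabs (k s - k x)) (fun _ => _));
    [| apply continuous_const].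
  apply (continuous_plus (fun x => 2 * Rabs (mu s - mu x)) (fun x => Rabs (k s - k x)));
    [| now apply Habs].
  apply (continuous_scal_r 2 (fun x => Rabs (mu s - mu x))); now apply Habs.
Qed.

(* The advance over a period is [2 PI] times an integer for every [n], is
   continuous in [n], and tends to [2 PI (N + 1)] as [n] tends to 0. *)
Lemma pf_orbit_rotation (N : nat) (n : R) : 0 < n ->
  flow (INR (S N)) (pf_value (S N) n) (2 * n) ((-1) ^ N * (PI / 2)) (2 * PI)
  = (-1) ^ N * (PI / 2) + 2 * PI * INR (S N).
Proof.
intros Hn; pose proof PI_RGT_0 as HPI.
set (p := (-1) ^ N * (PI / 2)); set (l := INR (S N)).
pose (g := fun s => flow l (pf_value (S N) s) (2 * s) p (2 * PI) - p - 2 * PI * l).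
assert (Hcont : forall s, 0 < s -> continuity_pt g s).
{ intros s Hs; unfold g.
  apply (continuity_pt_minus (fun s => flow l (pf_value (S N) s) (2 * s) p (2 * PI) - p) (fun _ => 2 * PI * l)).
  - apply (continuity_pt_minus (fun s => flow l (pf_value (S N) s) (2 * s) p (2 * PI)) (fun _ => p)).
    + apply (flow_continuous l p (2 * PI) (pf_value (S N)) (fun s => 2 * s)).
      * lra.
      * apply pf_value_continuous; [lia | trivial].
      * apply (ex_derive_continuous (fun s => 2 * s)); auto_derive; trivial.
    + apply continuity_pt_const; now intros x y.
  - apply continuity_pt_const; now intros x y. }
assert (Hint : forall s, 0 < s -> exists m : Z, g s = 2 * PI * IZR m).
{ intros s Hs; destruct (pf_value_spec (S N) s ltac:(lia) Hs) as [_ [b Hb]].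
  destruct (orbit_closes N s (pf_value (S N) s) b (flow l (pf_value (S N) s) (2 * s) p) Hs Hb
    (flow_orbit _ _ _ _) (flow_0 _ _ _ _)) as [m Hm].
  exists m; unfold g; rewrite Hm, flow_0; fold l; ring. }
assert (Hdev : forall s, 0 < s -> Rabs (g s) <= 4 * PI * s).
{ intros s Hs; pose proof (orbit_deviation l (pf_value (S N) s) (2 * s) _ ltac:(lra)
    (flow_orbit l (pf_value (S N) s) (2 * s) p)) as H.
  rewrite flow_0 in H; unfold g; lra. }
(* For [s <= 1/8] the deviation is at most [PI / 2], and the only multiple of [2 * PI] in that range
   is 0. *)
assert (Hmin : 0 < Rmin n (/ 8)) by (apply Rmin_pos; lra).
set (s0 := Rmin n (/ 8)) in *.
assert (H0 : g s0 = 0).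
{ destruct (Hint s0 Hmin) as [m Hm]; specialize (Hdev s0 Hmin).
  assert (s0 <= / 8) by apply Rmin_r.
  assert (Hb : Rabs (g s0) <= PI / 2) by nra.
  apply Rabs_le_between in Hb; rewrite Hm in Hb |- *.
  assert (Hm1 : (-1 < m)%Z) by (apply lt_IZR; simpl; nra).
  assert (Hm2 : (m < 1)%Z) by (apply lt_IZR; simpl; nra).
  replace m with 0%Z by lia; ring. }
assert (Hgn : g n = 0); [| unfold g in Hgn; lra].
destruct (Hint n Hn) as [m Hm].
destruct (Req_dec s0 n) as [E | E]; [now rewrite <- E |].
assert (Hs0 : s0 < n) by (pose proof (Rmin_l n (/ 8)); fold s0 in H; lra).
(* A jump to a nonzero multiple of [2 * PI] would pass through [PI] or [- PI]. *)
assert (Hhalf : forall z, 0 < z -> g z <> PI /\ g z <> - PI).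
{ intros z Hz; destruct (Hint z Hz) as [m' Hm']; rewrite Hm'; split; intros Heq.
  - assert (IZR (2 * m') = IZR 1) by (rewrite mult_IZR; simpl; nra).
    apply eq_IZR in H; lia.
  - assert (IZR (2 * m') = IZR (-1)) by (rewrite mult_IZR; simpl; nra).
    apply eq_IZR in H; lia. }
destruct (Z.lt_trichotomy m 0) as [Hneg | [Hz | Hpos]].
- exfalso.
  assert (IZR m <= -1) by (apply IZR_le; lia).
  destruct (Ranalysis5.IVT_interv (fun s => - g s - PI) s0 n) as [z [Hz1 Hz2]]; trivial.
  + intros s Hs; apply (continuity_pt_minus (fun s => - g s) (fun _ => PI)).
    * apply (continuity_pt_opp g), Hcont; lra.
    * apply continuity_pt_const; now intros x y.
  + rewrite H0; lra.
  + rewrite Hm; nra.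
  + apply (proj2 (Hhalf z ltac:(lra))); lra.
- rewrite Hm, Hz; ring.
- exfalso.
  assert (1 <= IZR m) by (apply IZR_le; lia).
  destruct (Ranalysis5.IVT_interv (fun s => g s - PI) s0 n) as [z [Hz1 Hz2]]; trivial.
  + intros s Hs; apply (continuity_pt_minus g (fun _ => PI)).
    * apply Hcont; lra.
    * apply continuity_pt_const; now intros x y.
  + rewrite H0; lra.
  + rewrite Hm; nra.
  + apply (proj1 (Hhalf z ltac:(lra))); lra.
Qed.

Lemma is_solution_iff (omega l A : R) (phi : R -> R) : 0 < omega ->
  is_solution omega (l * omega) A phi <-> is_orbit l (A / (2 * omega)) (/ omega) phi.
Proof.
intros Ho; unfold is_solution, is_orbit.
assert (E : forall t, vf omega (l * omega) A (phi t) t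
  = l + 2 * (A / (2 * omega)) * cos t - / omega * sin (phi t)).
{ intros t; unfold vf; field; lra. }
split; intros H t; specialize (H t); [now rewrite E in H | now rewrite E].
Qed.

Lemma periodic_orbit_in_L (omega l A : R) (s : Z) (phi : R -> R) : 0 < omega ->
  is_orbit l (A / (2 * omega)) (/ omega) phi -> phi (2 * PI) = phi 0 + 2 * PI * IZR s ->
  in_L s omega (l * omega) A /\ poincare_fixes omega (l * omega) A (phi 0).
Proof.
intros Ho H Hs; split.
- intros psi Hpsi; apply is_solution_iff in Hpsi; trivial.
  exact (orbit_rotation _ _ _ _ _ _ H Hs Hpsi).
- exists phi; split; [now apply is_solution_iff | split; [trivial | now exists s]].
Qed.

Lemma antipodal_start (N : nat) (p : R) : p = (-1) ^ N * (PI / 2) ->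
  exists m : Z, - p = p + 2 * PI * IZR m + PI.
Proof.
intros ->; destruct (pow_opp1 N) as [E | E]; rewrite E.
- exists (-1)%Z; lra.
- exists 0%Z; lra.
Qed.

(** * The intersection point and the advances of both phases there *)

Section GeneralizedSimpleIntersection.
Variables (N : nat) (omega : R).
Hypothesis omega_pos : 0 < omega.

Let l : R := INR (S N).
Let n : R := / (2 * omega).
Let mu : R := pf_value (S N) n.
Let p : R := (-1) ^ N * (PI / 2).

Lemma pf_parameter_pos : 0 < n.
Proof. apply Rinv_0_lt_compat; lra. Qed.

Lemma two_pf_parameter : 2 * n = / omega.
Proof. unfold n; field; lra. Qed.

Lemma pf_parameter_value_pos : 0 < mu.
Proof.
destruct (pf_value_spec (S N) n ltac:(lia) pf_parameter_pos) as [H _].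
pose proof pf_parameter_pos; fold mu in H; lra.
Qed.

Lemma flow_pf_period : flow l mu (/ omega) p (2 * PI) = p + 2 * PI * l.
Proof. rewrite <- two_pf_parameter; apply pf_orbit_rotation, pf_parameter_pos. Qed.

(** The start [- p] is midway between two consecutive translates of [p], whose orbits trap its
    orbit: its advance differs from [2 * PI * l] by at most [PI]. *)
Lemma flow_antipode_between : exists m : Z,
  - p = p + 2 * PI * IZR m + PI /\
  p + 2 * PI * l + 2 * PI * IZR m <= flow l mu (/ omega) (- p) (2 * PI)
    <= p + 2 * PI * l + 2 * PI * (IZR m + 1).
Proof.
pose proof PI_RGT_0.
destruct (antipodal_start N p eq_refl) as [m Hm]; exists m; split; trivial.
rewrite <- flow_pf_period.
apply (orbit_between l mu (/ omega)); try apply flow_orbit; [lra |].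
rewrite !flow_0; lra.
Qed.

Lemma flow_antipode_period :
  flow l mu (/ omega) (- p) (2 * PI) <> - p + 2 * PI * l.
Proof.
destruct (pf_value_spec (S N) n ltac:(lia) pf_parameter_pos) as [_ [b Hb]].
pose proof pf_parameter_pos as Hn.
pose proof (pf_value_bound N n _ b ltac:(lra) Hb) as Hbound.
assert (Hb2 : 2 * pf_value (S N) n <= 2 * n + INR (S N)) by (rewrite S_INR; lra).
intros H; rewrite <- two_pf_parameter in H.
refine (pf_orbit_not_identity N n mu b (flow l mu (2 * n) p) (flow l mu (2 * n) (- p))
  Hn pf_parameter_value_pos Hb2 Hb (flow_orbit _ _ _ _) _ _ (flow_orbit _ _ _ _) _ _).
- apply flow_0.
- rewrite flow_0, two_pf_parameter; apply flow_pf_period.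
- now rewrite !flow_0.
- now rewrite flow_0.
Qed.

(** Under the identity the orbit of [- p] would advance by [2 * PI * j]; being trapped forces
    [j = l], which [flow_antipode_period] excludes. *)
Lemma pf_not_identity (A : R) : A / (2 * omega) = mu ->
  ~ poincare_identity omega (l * omega) A.
Proof.
intros HA Hid; pose proof PI_RGT_0.
assert (Ho := flow_orbit l mu (/ omega) (- p)).
rewrite <- HA in Ho; apply is_solution_iff in Ho; trivial.
rewrite HA in Ho.
destruct (Hid _ Ho) as [j Hj]; rewrite flow_0 in Hj.
apply flow_antipode_period; rewrite Hj.
destruct flow_antipode_between as [m [Hm Hb]]; rewrite Hj in Hb.
assert (E : j = Z.of_nat (S N)); [| subst j; now rewrite <- INR_IZR_INZ].
unfold l in Hb; rewrite INR_IZR_INZ in Hb.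
assert ((Z.of_nat (S N) < j + 1)%Z) by (apply lt_IZR; rewrite plus_IZR; nra).
assert ((j < Z.of_nat (S N) + 1)%Z) by (apply lt_IZR; rewrite plus_IZR; nra).
lia.
Qed.

Lemma flow_pf_advance (q : R) : q = PI / 2 \/ q = - (PI / 2) ->
  q + 2 * PI * l - PI <= flow l mu (/ omega) q (2 * PI).
Proof.
intros Hq; pose proof PI_RGT_0.
assert (Hqp : q = p \/ q = - p).
{ unfold p; destruct (pow_opp1 N) as [E | E]; rewrite E; destruct Hq as [-> | ->].
  - left; ring.
  - right; ring.
  - right; ring.
  - left; ring. }
destruct Hqp as [-> | ->].
- rewrite flow_pf_period; lra.
- destruct flow_antipode_between as [m [Hm Hb]]; lra.
Qed.
End GeneralizedSimpleIntersection.

(** * Orbits at zero forcing *)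

Section ZeroForcing.
Variables (l omega : R) (phi : R -> R).
Hypothesis omega_pos : 0 < omega.
Hypothesis l_nonneg : 0 <= l.
Hypothesis l_omega : l * omega < 1.
Hypothesis phi_orbit : is_orbit l 0 (/ omega) phi.

Lemma equilibrium : exists q, 0 <= q <= PI / 2 /\ sin q = l * omega /\
  is_orbit l 0 (/ omega) (fun _ => q) /\ is_orbit l 0 (/ omega) (fun _ => PI - q).
Proof.
assert (0 <= l * omega) by (apply Rmult_le_pos; lra).
assert (Hs : sin (asin (l * omega)) = l * omega) by (apply sin_asin; lra).
assert (Hb := asin_bound (l * omega)).
exists (asin (l * omega)).
assert (Hq : 0 <= asin (l * omega)).
{ destruct (Rle_lt_dec 0 (asin (l * omega))) as [H0 | H0]; trivial; exfalso.
  pose proof PI_RGT_0; pose proof (sin_gt_0 (- asin (l * omega)) ltac:(lra) ltac:(lra)) as Hp.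
  rewrite sin_neg in Hp; lra. }
split; [lra | split; [trivial | split]]; intros t;
  (eapply is_derive_value; [apply is_derive_const |]).
- rewrite Hs; unfold zero; simpl; field; lra.
- rewrite sin_PI_x, Hs; unfold zero; simpl; field; lra.
Qed.

(** The orbit stays between the equilibria [q] and [PI - q], where [sin] is at least [l * omega] and
    the field is nonpositive. *)
Lemma zero_forcing_plus : phi 0 = PI / 2 -> phi (2 * PI) <= PI / 2.
Proof.
intros H0; pose proof PI_RGT_0.
destruct equilibrium as [q [Hq [Hs [H1 H2]]]].
destruct (MVT_gen phi 0 (2 * PI) (fun t => l + 2 * 0 * cos t - / omega * sin (phi t))) as [c [Hc1 Hc]].
- intros; apply phi_orbit.
- intros; apply continuity_pt_filterlim; eapply orbit_continuous, phi_orbit.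
- rewrite Rmin_left, Rmax_right in Hc1 by lra.
  assert (Hc2 : q <= phi c <= PI - q).
  { split.
    - apply (orbit_le l 0 (/ omega) (fun _ => q) phi 0 c); trivial; lra.
    - apply (orbit_le l 0 (/ omega) phi (fun _ => PI - q) 0 c); trivial; lra. }
  assert (Hsin : sin q <= sin (phi c)).
  { destruct (Rle_dec (phi c) (PI / 2)).
    - apply sin_incr_1; lra.
    - rewrite <- (sin_PI_x (phi c)); apply sin_incr_1; lra. }
  assert (Hl : l <= / omega * sin (phi c)).
  { rewrite Hs in Hsin; apply Rmult_le_compat_l with (r := / omega) in Hsin;
      [| apply Rlt_le, Rinv_0_lt_compat; lra].
    replace (/ omega * (l * omega)) with l in Hsin by (field; lra); trivial. }
  nra.
Qed.

(** The equilibrium [q] is a barrier. The advance is at most [PI], which suffices for [s >= 1]. *)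
Lemma zero_forcing_minus : phi 0 = - (PI / 2) -> phi (2 * PI) <= PI / 2.
Proof.
intros H0; pose proof PI_RGT_0.
destruct equilibrium as [q [Hq [Hs [H1 H2]]]].
apply Rle_trans with q; [| lra].
apply (orbit_le l 0 (/ omega) phi (fun _ => q) 0); trivial; lra.
Qed.
End ZeroForcing.

Lemma semiaxis_meets_boundary (N s : nat) (omega q : R) :
  0 < omega -> (s <= N)%nat -> q = PI / 2 \/ q = - (PI / 2) ->
  flow (INR (S N)) 0 (/ omega) q (2 * PI) <= q + 2 * PI * INR s ->
  exists A, 0 <= A /\ in_L (Z.of_nat s) omega (INR (S N) * omega) A /\
    poincare_fixes omega (INR (S N) * omega) A q.
Proof.
intros Ho Hs Hq H0; pose proof PI_RGT_0.
pose proof (flow_pf_advance N omega Ho q Hq) as H1.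
pose proof (pf_parameter_value_pos N omega Ho) as Hmu.
set (mu := pf_value (S N) (/ (2 * omega))) in *.
apply le_INR in Hs.
destruct (IVT_gen (fun m => flow (INR (S N)) m (/ omega) q (2 * PI)) 0 mu (q + 2 * PI * INR s))
  as [m [Hm1 Hm2]].
- intros m; apply (flow_continuous (INR (S N)) q (2 * PI) (fun m => m) (fun _ => / omega)).
  + lra.
  + apply continuous_id.
  + apply continuous_const.
(* As [s <= N = l - 1], losing half a turn from [2 * PI * l] still leaves at least [2 * PI * s]. *)
- rewrite S_INR in H1 at 1.
  assert (Hle : q + 2 * PI * INR s <= flow (INR (S N)) mu (/ omega) q (2 * PI)) by nra.
  split.
  + eapply Rle_trans; [apply Rmin_l | trivial].
  + eapply Rle_trans; [exact Hle | apply Rmax_r].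
- rewrite Rmin_left in Hm1 by lra.
  exists (2 * omega * m); split; [apply Rmult_le_pos; lra |].
  assert (E : 2 * omega * m / (2 * omega) = m) by (field; lra).
  pose proof (periodic_orbit_in_L omega (INR (S N)) (2 * omega * m) (Z.of_nat s)
    (flow (INR (S N)) m (/ omega) q) Ho) as Hp.
  rewrite E, flow_0, <- INR_IZR_INZ in Hp.
  apply Hp; [apply flow_orbit | trivial].
Qed.

Lemma small_omega (l : nat) (omega : R) : (1 <= l)%nat -> omega < / INR l -> INR l * omega < 1.
Proof.
intros Hl Ho; apply lt_0_INR in Hl.
apply Rmult_lt_compat_l with (r := INR l) in Ho; trivial.
now rewrite Rinv_r in Ho by lra.
Qed.

Theorem theorem1p18 :
  (* (1) *)
  (forall (l : nat) (omega : R), (1 <= l)%nat -> 0 < omega ->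
     exists A : R,
       on_semiaxis (Z.of_nat l) omega (INR l * omega) A /\
       gen_simple_intersection omega (INR l * omega) A /\
       boundary (Z.of_nat l) omega (INR l * omega) A)
  /\
  (* (2) *)
  (forall l : nat, (3 <= l)%nat ->
     exists omega0 : R, 0 < omega0 /\
       forall (s : nat) (omega : R),
         Nat.even (l - s) = true -> (0 < s)%nat -> (s < l)%nat ->
         0 < omega -> omega < omega0 ->
         (exists A : R, on_semiaxis (Z.of_nat l) omega (INR l * omega) A /\
            boundary_plus (Z.of_nat s) omega (INR l * omega) A) /\
         (exists A : R, on_semiaxis (Z.of_nat l) omega (INR l * omega) A /\
            boundary_minus (Z.of_nat s) omega (INR l * omega) A))
  /\
  (* (3) *)
  (forall l : nat, (2 <= l)%nat ->
     exists omega0 : R, 0 < omega0 /\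
       forall omega : R, 0 < omega -> omega < omega0 ->
         exists A : R, on_semiaxis (Z.of_nat l) omega (INR l * omega) A /\
           boundary_plus 0%Z omega (INR l * omega) A).
Proof.
assert (HB : forall l omega, INR l * omega = IZR (Z.of_nat l) * omega)
  by (intros; now rewrite <- INR_IZR_INZ).
pose proof PI_RGT_0 as HPI.
split; [| split].
- intros l omega Hl Ho; destruct l as [|N]; [lia |].
  pose (mu := pf_value (S N) (/ (2 * omega))).
  pose (p := (-1) ^ N * (PI / 2)).
  assert (Hmu := pf_parameter_value_pos N omega Ho); fold mu in Hmu.
  exists (2 * omega * mu).
  assert (E : 2 * omega * mu / (2 * omega) = mu) by (field; lra).
  assert (Hbd : boundary (Z.of_nat (S N)) omega (INR (S N) * omega) (2 * omega * mu)).
  { pose proof (periodic_orbit_in_L omega (INR (S N)) (2 * omega * mu) (Z.of_nat (S N))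
      (flow (INR (S N)) mu (/ omega) p) Ho) as Hp.
    rewrite E, flow_0, <- INR_IZR_INZ in Hp.
    destruct (Hp (flow_orbit _ _ _ _) (flow_pf_period N omega Ho)) as [H1 H2].
    (* The component is the plus one for odd [l] and the minus one for even [l]. *)
    unfold p in H2; destruct (pow_opp1 N) as [Hs | Hs]; rewrite Hs in H2.
    - left; split; trivial; now rewrite Rmult_1_l in H2.
    - right; split; trivial; now replace (-1 * (PI / 2)) with (- (PI / 2)) in H2 by ring. }
  split; [| split; trivial].
  + split; [apply HB | apply Rmult_le_pos; lra].
  + exists (Z.of_nat (S N)), (Z.of_nat (S N)).
    split; [apply HB | split; [trivial | split]].
    * now rewrite Z.sub_diag.
    * intros [_ [_ Hid]]; now apply (pf_not_identity N omega Ho _ E).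
(* Below [1 / l] one has [l * omega < 1], so the equilibria at zero forcing exist. *)
- intros l Hl; exists (/ INR l); split; [apply Rinv_0_lt_compat, lt_0_INR; lia |].
  intros s omega _ Hs Hsl Ho Ho'.
  assert (Hlo := small_omega l omega ltac:(lia) Ho').
  destruct l as [|N]; [lia |].
  assert (1 <= INR s) by (apply (le_INR 1); lia).
  split.
  + destruct (semiaxis_meets_boundary N s omega (PI / 2) Ho ltac:(lia) (or_introl eq_refl))
      as [A [HA HA']].
    * pose proof (zero_forcing_plus (INR (S N)) omega _ Ho (pos_INR _) Hlo
        (flow_orbit _ _ _ _) (flow_0 _ _ _ _)); nra.
    * exists A; split; [split; [apply HB | trivial] | exact HA'].
  + destruct (semiaxis_meets_boundary N s omega (- (PI / 2)) Ho ltac:(lia) (or_intror eq_refl))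
      as [A [HA HA']].
    * pose proof (zero_forcing_minus (INR (S N)) omega _ Ho (pos_INR _) Hlo
        (flow_orbit _ _ _ _) (flow_0 _ _ _ _)); nra.
    * exists A; split; [split; [apply HB | trivial] | exact HA'].
- intros l Hl; exists (/ INR l); split; [apply Rinv_0_lt_compat, lt_0_INR; lia |].
  intros omega Ho Ho'.
  assert (Hlo := small_omega l omega ltac:(lia) Ho').
  destruct l as [|N]; [lia |].
  destruct (semiaxis_meets_boundary N 0 omega (PI / 2) Ho ltac:(lia) (or_introl eq_refl))
    as [A [HA HA']].
  + pose proof (zero_forcing_plus (INR (S N)) omega _ Ho (pos_INR _) Hlo
      (flow_orbit _ _ _ _) (flow_0 _ _ _ _)); simpl (INR 0); lra.
  + exists A; split; [split; [apply HB | trivial] | exact HA'].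
Qed.
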